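(* Let $k\in\mathbb{N}^+$ and $d,d'\in\mathbb{N}$. Let $R^{(1)},\dots,R^{(d)},R^{(-1)},\dots,R^{(-d')}\subseteq X\times Y$ be $(k,1)$-semi-equations, and let $$R=R^{(1)}\wedge\dots\wedge R^{(d)}\wedge\neg R^{(-1)}\wedge\dots\wedge\neg R^{(-d')}$$ (the empty conjunction being the full relation $X\times Y$). Then, for all $t,m,n\in\mathbb{N}^+$, $$z_t^R(m,n)\leq\begin{cases}(t-1)(m+n)&\text{if }d'=d=0,\\ 8^{d-1}k^{4d-3}(t-1)^2(m+n)\log^{2d-2}(m+1)&\text{if }d'=0\text{ and }d>0,\\ 8^{d+d'-1}k^{4d+d'}(d'!)\,t^{d'+1}(m+n)\log^{2d+d'-1}(m+1)&\text{if }d'>0.\end{cases}$$ Thus, any (finite) Boolean combination of $(k,1)$-semi-equations has almost linear Zarankiewicz bounds, and any $(k,1)$-semi-equational theory does not interpret an infinite field.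
   Context: $\mathbb{N}=\{0,1,2,\dots\}$, $\mathbb{N}^+=\{1,2,\dots\}$, $[k]=\{1,\dots,k\}$; $\log$ is the natural logarithm and $\log^{j}(x)=(\log x)^j$. $X,Y$ are arbitrary sets. For $R\subseteq X\times Y$ and $y\in Y$, $R_y:=\{x\in X:(x,y)\in R\}$ is a fibre of $R$; for $A\subseteq X$, $B\subseteq Y$, $R(A,B):=R\cap(A\times B)$. Boolean operations on relations are the set operations: $\wedge$ is intersection, $\vee$ is union, $\neg R=(X\times Y)\setminus R$. $R\subseteq X\times Y$ is a $(k,1)$-semi-equation if for all $y_1,\dots,y_k\in Y$ with $\bigcap_{i\in[k]}R_{y_i}\neq\emptyset$ there are distinct $i,j\in[k]$ such that $R_{y_i}\subseteq R_{y_j}$. A relation $E\subseteq A\times B$ is $K_{t,t}$-free if there are no $A'\subseteq A$, $B'\subseteq B$ with $|A'|=|B'|=t$ and $A'\times B'\subseteq E$. For $t,m,n\in\mathbb{N}^+$, $$z_t^R(m,n):=\max\{|R(A,B)|:A\subseteq X,\ B\subseteq Y,\ |A|=m,\ |B|=n,\ R(A,B)\text{ is }K_{t,t}\text{-free}\},$$ with the maximum of the empty set taken to be $0$. $R$ has almost linear Zarankiewicz bounds if for all $t\in\mathbb{N}^+$ and real $\varepsilon>0$ there is a constant $C=C(t,\varepsilon)$ with $z_t^R(n,n)\leq Cn^{1+\varepsilon}$ for all $n\in\mathbb{N}^+$. A first-order theory $T$ is $(k,1)$-semi-equational if every formula $\varphi(x;y)$ ($x,y$ tuples of variables) is, modulo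 $T$, a Boolean combination of formulas $\varphi_1(x;y),\dots,\varphi_l(x;y)$ each of which defines a $(k,1)$-semi-equation (between the set of $x$-tuples and the set of $y$-tuples) in models of $T$. ''$T$ does not interpret an infinite field'' means that no infinite field is interpretable in a model of $T$. *)

(* Defs.v *)
From mathcomp Require Import all_boot all_order all_algebra.
From mathcomp Require Import all_classical all_reals all_analysis.

Set Implicit Arguments.
Unset Strict Implicit.
Unset Printing Implicit Defensive.

Local Open Scope classical_set_scope.
Local Open Scope card_scope.

Section Relations.
Variables X Y : Type.
Implicit Types (E R : set (X * Y)) (A : set X) (B : set Y).

(* The fibre of [R] at [y] is [ysection R y], a subset of [X]. *)
Definition semi_equation (k : nat) R : Prop :=
  forall y : 'I_k -> Y,
    \bigcap_i ysection R (y i) !=set0 ->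
    exists i j : 'I_k, i != j /\ ysection R (y i) `<=` ysection R (y j).

Definition Ktt_free (t : nat) E : Prop :=
  ~ exists (A : set X) (B : set Y),
      [/\ A #= `I_t, B #= `I_t & A `*` B `<=` E].

Definition is_edge_count (t m n : nat) R (e : nat) : Prop :=
  exists (A : set X) (B : set Y),
    [/\ A #= `I_m, B #= `I_n, Ktt_free t (R `&` (A `*` B))
      & R `&` (A `*` B) #= `I_e].

(* No edge count exceeds [m * n], so the range of the maximum loses nothing;
   a maximum over no value at all is [0]. *)
Definition zarankiewicz (t m n : nat) R : nat :=
  \max_(e < (m * n).+1 | `[< is_edge_count t m n R e >]) e.

Definition almost_linear_zarankiewicz (F : realType) R : Prop :=
  forall (t : nat) (eps : F), (0 < t)%N -> (0 < eps)%R ->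
    exists C : F, forall n : nat, (0 < n)%N ->
      ((zarankiewicz t n n R)%:R <= C * n%:R `^ (1 + eps))%R.

End Relations.

(* Boolean combinations of (finitely many) members of a family of subsets. *)
Inductive bool_comb_set (T : Type) (G : set (set T)) : set T -> Prop :=
| bcs_gen A of G A : bool_comb_set G A
| bcs_full : bool_comb_set G setT
| bcs_compl A of bool_comb_set G A : bool_comb_set G (~` A)
| bcs_inter A B of bool_comb_set G A & bool_comb_set G B :
    bool_comb_set G (A `&` B)
| bcs_union A B of bool_comb_set G A & bool_comb_set G B :
    bool_comb_set G (A `|` B).

(* One-sorted first-order languages. *)
Record language := Language {
  fsym : Type;
  farity : fsym -> nat;
  rsym : Type;
  rarity : rsym -> nat }.

Inductive term (L : language) (V : Type) : Type :=
| TVar of V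
| TApp (f : fsym L) of ('I_(farity f) -> term L V).

(* [formula L V]: the free variables lie in [V]; a quantifier binds the
   variable [None] of a formula with free variables in [option V]. *)
Inductive formula (L : language) (V : Type) : Type :=
| FTrue
| FEq of term L V & term L V
| FRel (r : rsym L) of ('I_(rarity r) -> term L V)
| FNot of formula L V
| FAnd of formula L V & formula L V
| FOr of formula L V & formula L V
| FEx of formula L (option V)
| FAll of formula L (option V).

Record structure (L : language) := Structure {
  carrier :> Type;
  carrier_inhabited : inhabited carrier;
  finterp : forall f : fsym L, ('I_(farity f) -> carrier) -> carrier;
  rinterp : forall r : rsym L, ('I_(rarity r) -> carrier) -> Prop }.

Fixpoint eval (L : language) (M : structure L) (V : Type) (v : V -> M)
    (s : term L V) : M :=
  match s with
  | TVar x => v x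
  | TApp f ss => finterp (fun i => eval v (ss i))
  end.

Fixpoint sat (L : language) (M : structure L) (V : Type)
    (phi : formula L V) : (V -> M) -> Prop :=
  match phi with
  | FTrue => fun=> True
  | FEq s1 s2 => fun v => eval v s1 = eval v s2
  | FRel r ss => fun v => rinterp (fun i => eval v (ss i))
  | FNot psi => fun v => ~ sat psi v
  | FAnd psi1 psi2 => fun v => sat psi1 v /\ sat psi2 v
  | FOr psi1 psi2 => fun v => sat psi1 v \/ sat psi2 v
  | FEx psi => fun v => exists a : M, sat psi (oapp v a)
  | FAll psi => fun v => forall a : M, sat psi (oapp v a)
  end.

Definition theory (L : language) := set (formula L void).

Definition is_model (L : language) (T : theory L) (M : structure L) : Prop :=
  forall phi, T phi -> sat phi (of_void M).

(* A formula phi(x; y) with x a [p]-tuple and y a [q]-tuple of variables is a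
   formula with free variables in ['I_p + 'I_q]. *)
Definition assign2 (U V M : Type) (x : U -> M) (y : V -> M) : U + V -> M :=
  fun w => match w with inl i => x i | inr j => y j end.

Definition defined_rel (L : language) (M : structure L) (p q : nat)
    (phi : formula L ('I_p + 'I_q)) : set (('I_p -> M) * ('I_q -> M)) :=
  [set xy | sat phi (assign2 xy.1 xy.2)].
Arguments defined_rel {L} M {p q} phi.

Inductive bool_comb_formula (L : language) (V : Type)
    (G : set (formula L V)) : formula L V -> Prop :=
| bcf_gen phi of G phi : bool_comb_formula G phi
| bcf_true : bool_comb_formula G (FTrue L V)
| bcf_not phi of bool_comb_formula G phi : bool_comb_formula G (FNot phi)
| bcf_and phi psi of bool_comb_formula G phi & bool_comb_formula G psi :
    bool_comb_formula G (FAnd phi psi)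
| bcf_or phi psi of bool_comb_formula G phi & bool_comb_formula G psi :
    bool_comb_formula G (FOr phi psi).

Definition semi_equation_formula (L : language) (T : theory L) (k p q : nat) :
    set (formula L ('I_p + 'I_q)) :=
  [set phi | forall M : structure L, is_model T M ->
     semi_equation k (defined_rel M phi)].

Definition semi_equational (L : language) (k : nat) (T : theory L) : Prop :=
  forall (p q : nat) (phi : formula L ('I_p + 'I_q)),
    exists2 psi, bool_comb_formula (@semi_equation_formula L T k p q) psi &
      forall M : structure L, is_model T M ->
        forall v : 'I_p + 'I_q -> M, sat phi v <-> sat psi v.

(* Definability with (finitely many) parameters. *)
Definition definable (L : language) (M : structure L) (V : Type)
    (D : set (V -> M)) : Prop :=
  exists (c : nat) (a : 'I_c -> M) (phi : formula L (V + 'I_c)),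
    D = [set v | sat phi (assign2 v a)].

(* The preimage of [S], a subset of [N ^ n], under a partial coordinate map
   [f : M ^ e -> N] with domain [D]; the values of [f] off [D] are ignored. *)
Definition coord_preimage (M N : Type) (e : nat) (D : set ('I_e -> M))
    (f : ('I_e -> M) -> N) (n : nat) (S : set ('I_n -> N)) :
    set ('I_n * 'I_e -> M) :=
  [set v | (forall i, D (fun j => v (i, j))) /\
           S (fun i => f (fun j => v (i, j)))].

(* In the graph of an [n]-ary operation the last coordinate is the value. *)
Definition graph_of (N : Type) (n : nat) (g : ('I_n -> N) -> N) :
    set ('I_n.+1 -> N) :=
  [set u | u ord_max = g (fun i => u (widen_ord (leqnSn n) i))].

Definition interpretable (L L' : language) (M : structure L)
    (N : structure L') : Prop :=
  exists (e : nat) (D : set ('I_e -> M)) (f : ('I_e -> M) -> N),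
    [/\ definable D,
        forall b : N, exists2 x, D x & f x = b,
        definable (coord_preimage D f [set u : 'I_2 -> N | u ord0 = u ord_max]),
        forall g : fsym L',
          definable (coord_preimage D f (graph_of (@finterp L' N g)))
      & forall r : rsym L',
          definable (coord_preimage D f [set u | @rinterp L' N r u])].

Inductive ring_fsym := RZero | ROne | ROpp | RAdd | RMul.

Definition ring_arity (g : ring_fsym) : nat :=
  match g with RZero | ROne => 0 | ROpp => 1 | RAdd | RMul => 2 end.

Definition ring_language : language :=
  @Language ring_fsym ring_arity void (of_void nat).

Definition ring_finterp (K : fieldType) (g : ring_fsym) :
    ('I_(ring_arity g) -> K) -> K :=
  match g return ('I_(ring_arity g) -> K) -> K with
  | RZero => fun=> 0%R
  | ROne => fun=> 1%R
  | ROpp => fun u => (- u ord0)%R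
  | RAdd => fun u => (u ord0 + u ord_max)%R
  | RMul => fun u => (u ord0 * u ord_max)%R
  end.

Definition field_structure (K : fieldType) : structure ring_language :=
  @Structure ring_language K (inhabits 0%R) (@ring_finterp K)
    (fun r : void => match r with end).

Definition interprets_infinite_field (L : language) (T : theory L) : Prop :=
  exists (M : structure L) (K : fieldType),
    [/\ is_model T M, infinite_set [set: K]
      & interpretable M (field_structure K)].

(* Main.v *)
(** The edges of a [K_{t,t}]-free conjunction of literals between finite sets [A] and
    [B] are bounded by induction on the number of literals.

    For a semi-equation the sets [fib s A b] containing a given point have no
    antichain of size [k], so by Dilworth's theorem they form [k - 1] chains.  If all
    the [fib s A b] form one chain, halving [A] along the chain splits [s] (and its
    complement) into complete bipartite pieces at the cost of one logarithm, and on
    such a piece one literal disappears.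

    A positive literal is removed by grouping the [b] according to the dyadic size of
    [fib s A b], and each group into clusters above its minimal sets; every cluster is
    a union of [k - 1] chains and every [a] meets at most [2 (k - 1)^2] clusters of a
    group.  This costs two logarithms, except that a single positive literal can be
    treated directly.

    For a conjunction of [d] negative literals, [K_{t,t}]-freeness forces the
    [fib (s j) A b] to be large for almost all [b], and then double counting of degrees
    gives a chain for some literal that carries a proportion [1 / (t d k)] of the edges.

    Finally, the [K_{2,2}]-free point-line incidence relation of an infinite field has
    order of [n^(4/3)] edges between suitable [n] points and [n] lines: the coordinates
    range over arithmetic progressions in characteristic 0, and over the span of the
    first powers of an element of large degree over the prime field otherwise. *)
Require Import Defs.
From mathcomp Require Import all_boot.
From mathcomp Require Import zify.

Set Implicit Arguments.
Unset Strict Implicit.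
Unset Printing Implicit Defensive.

(** * Dilworth's theorem *)

(** Meant for preorders: distinct equivalent elements, such as two [b] with equal fibres, count as
    comparable. *)
Definition antichain (T : finType) (le : rel T) (Q : {set T}) : Prop :=
  forall x y, x \in Q -> y \in Q -> le x y -> x = y.

Lemma antichainS (T : finType) (le : rel T) (P Q : {set T}) :
  P \subset Q -> antichain le Q -> antichain le P.
Proof. by move=> /subsetP sPQ aQ x y /sPQ xQ /sPQ yQ; apply: aQ. Qed.

Definition chain_cover (T : finType) (le : rel T) (P : {set T}) (w : nat)
    (f : T -> nat) : Prop :=
  (forall x, x \in P -> f x < w) /\
  (forall x y, x \in P -> y \in P -> f x = f y -> le x y || le y x).

(* Galvin's proof: remove a maximal element [a] and, in each chain of an optimal
   cover of the rest, consider the top element that lies on a maximum antichain. *)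
Theorem dilworth (T : finType) (le : rel T) (P : {set T}) (w : nat) :
  reflexive le -> transitive le ->
  (forall Q : {set T}, Q \subset P -> antichain le Q -> #|Q| <= w) ->
  exists f, chain_cover le P w f.
Proof.
move=> le_refl le_trans.
have [n] := ubnP #|P|; elim: n P w => // n IHn P w Pn wP.
have [->|/set0Pn[a0 a0P]] := eqVneq P set0.
  by exists (fun=> 0); split=> x; rewrite inE.
(* In a preorder, maximality holds only up to equivalence; [a] is found by minimising the number of
   elements above it. *)
have [a aP amax] : exists2 a, a \in P & forall x, x \in P -> le a x -> le x a.
  have [a aP0 amax] := arg_minnP (fun x => #|[set y in P | le x y]|) a0P.
  have aP : a \in P := aP0.
  exists a => // x xP ax; have := amax x xP; rewrite leqNgt => /negP lt_ax.
  apply/negPn/negP => nxa; apply: lt_ax; apply/proper_card/properP; split.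
    by apply/subsetP=> y; rewrite !inE => /andP[-> /(le_trans _ _ _ ax)].
  by exists a; rewrite !inE aP ?le_refl.
pose P' := P :\ a.
have sP'P : P' \subset P by apply: subsetDl.
have P'n : #|P'| < n by move: Pn; rewrite (cardsD1 a P) aP.
pose isanti (Q : {set T}) :=
  (Q \subset P') && [forall x in Q, forall y in Q, le x y ==> (x == y)].
have antiP (Q : {set T}) : reflect (Q \subset P' /\ antichain le Q) (isanti Q).
  apply: (iffP andP) => -[sQ H]; split=> //.
    move=> x y xQ yQ xy; have /forall_inP/(_ x xQ)/forall_inP/(_ y yQ) := H.
    by rewrite xy => /eqP.
  by apply/forall_inP=> x xQ; apply/forall_inP=> y yQ; apply/implyP=> /H->.
have isanti0 : isanti set0 by apply/antiP; split=> [|x]; rewrite ?sub0set ?inE.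
have [Q0 /antiP[sQ0 aQ0] Q0max] := arg_maxnP (fun Q : {set T} => #|Q|) isanti0.
set v := #|Q0| in Q0max.
have vP' (Q : {set T}) : Q \subset P' -> antichain le Q -> #|Q| <= v.
  by move=> sQ aQ; apply: Q0max; apply/antiP.
have vw : v <= w by apply: wP => //; apply: subset_trans sP'P.
have [f [fv fchain]] := IHn P' v P'n vP'.
have finj (Q : {set T}) : Q \subset P' -> antichain le Q -> {in Q &, injective f}.
  move=> /subsetP sQ aQ x y xQ yQ fxy.
  by have /orP[/aQ->|/aQ<-] := fchain x y (sQ _ xQ) (sQ _ yQ) fxy.
(* An antichain meets each of the [v] chains at most once, so one with [v] elements meets them
   all. *)
have fsurj (Q : {set T}) i : Q \subset P' -> antichain le Q -> #|Q| = v -> i < v ->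
    exists2 x, x \in Q & f x = i.
  move=> sQ aQ Qv iv.
  have := @uniq_min_size _ [seq f x | x <- enum Q] (iota 0 v).
  rewrite map_inj_in_uniq ?enum_uniq; last first.
    by move=> x y; rewrite !mem_enum; apply: finj.
  rewrite size_map -cardE Qv size_iota => /(_ isT) [||_ /(_ i)] //.
    move=> _ /mapP[x + ->]; rewrite mem_enum => xQ.
    by rewrite mem_iota fv //; apply: (subsetP sQ).
  by rewrite mem_iota iv => /mapP[x]; rewrite mem_enum => xQ ->; exists x.
pose tops := [set x in P' | [exists Q : {set T}, [&& isanti Q, #|Q| == v & x \in Q]]].
have topsP x : reflect (exists Q : {set T}, [/\ Q \subset P', antichain le Q, #|Q| = v & x \in Q])
   (x \in tops).
  rewrite inE; apply: (iffP andP).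
    by move=> [_ /existsP[Q /and3P[/antiP[? ?] /eqP ? ?]]]; exists Q.
  move=> [Q [sQ aQ Qv xQ]]; split; first by apply: (subsetP sQ).
  by apply/existsP; exists Q; rewrite Qv eqxx xQ !andbT; apply/antiP.
have topmax i : i < v -> exists x, [/\ x \in tops, f x = i &
    forall y, y \in tops -> f y = i -> le y x].
  move=> iv; have [x0 x0Q fx0] := fsurj Q0 i sQ0 aQ0 erefl iv.
  have x0t : (x0 \in tops) && (f x0 == i).
    by rewrite fx0 eqxx andbT; apply/topsP; exists Q0.
  have [x /andP[xt /eqP fx] xmax] :=
    @arg_maxnP _ x0 (fun x => (x \in tops) && (f x == i))
      (fun x => #|[set y in P' | le y x]|) x0t.
  exists x; split=> // y yt fy.
  have xP' : x \in P' by have:= xt; rewrite inE => /andP[].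
  have yP' : y \in P' by have:= yt; rewrite inE => /andP[].
  have /orP[//|xy] := fchain y x yP' xP' (etrans fy (esym fx)).
  have := xmax y; rewrite yt fy eqxx /geq /= => /(_ isT).
  rewrite leqNgt => /negP lt.
  apply/negPn/negP => nyx; apply: lt; apply/proper_card/properP; split.
    apply/subsetP=> z; rewrite [in X in X -> _]inE [in X in _ -> X]inE.
    by move=> /andP[-> /le_trans]; apply.
  by exists y; rewrite !inE (setD1P yP').1 ?(setD1P yP').2 ?le_refl.
have [g gP] : exists g : 'I_v -> T, forall i : 'I_v, [/\ g i \in tops, f (g i) = i &
    forall y, y \in tops -> f y = i -> le y (g i)].
  have H (i : 'I_v) : exists x,
      [&& x \in tops, f x == i & [forall y in tops, (f y == i) ==> le y x]].
    have [x [xt fx xm]] := topmax i (ltn_ord i).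
    exists x; rewrite xt fx eqxx /=; apply/forall_inP=> y yt; apply/implyP=> /eqP.
    exact: xm.
  exists (fun i => xchoose (H i)) => i; have /and3P[? /eqP ? /forall_inP m] := xchooseP (H i).
  by split=> // y /m /implyP h /eqP; apply: h.
have gP' i : g i \in P' by have [] := gP i; rewrite inE => /andP[].
(* A maximum antichain through [g j] meets chain [i] in some [y] below [g i], hence below [g j]; so
   [y = g j] and the two chains coincide. *)
have ganti i j : le (g i) (g j) -> i = j.
  move=> gij; have [/topsP[Q [sQ aQ Qv giQ]] fgi _] := gP j.
  have [y yQ fy] := fsurj Q i sQ aQ Qv (ltn_ord i).
  have yg : le y (g i) by have [_ _ ->] // := gP i; apply/topsP; exists Q.
  have := aQ _ _ yQ giQ (le_trans _ _ _ yg gij) => yE.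
  by apply: val_inj; rewrite /= -fy yE fgi.
(* If no [g i] lies below [a], then [a] and all the [g i] form an antichain, so [v < w] and [a] may
   be a chain of its own. *)
have [/existsP[i gia]|nog] := boolP [exists i, le (g i) a]; last first.
  have aX : a \notin [set g i | i : 'I_v].
    by apply/imsetP => -[i _ ai]; have := gP' i; rewrite -ai !inE eqxx.
  have vw1 : v < w.
    have <- : #|a |: [set g i | i : 'I_v]| = v.+1.
      rewrite cardsU1 aX card_imset ?card_ord // => i j gij.
      by apply: ganti; rewrite gij.
    apply: wP => [|x y].
      apply/subsetP=> x /setU1P[->//|/imsetP[i _ ->]].
      exact: (subsetP sP'P).
    have ginc i : ~~ le (g i) a by move: nog; rewrite negb_exists => /forallP.
    move=> /setU1P[->|/imsetP[i _ ->]] /setU1P[->|/imsetP[j _ ->]] //.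
    - by move=> /amax; rewrite (subsetP sP'P) // (negPf (ginc _)) => /(_ isT).
    - by rewrite (negPf (ginc _)).
    - by move=> /ganti->.
  exists (fun x => if x == a then v else f x); split.
    move=> x xP; case: eqP => // /eqP xa; apply: leq_trans vw.
    by apply: fv; rewrite !inE xa.
  move=> x y xP yP; case: eqP => [->|/eqP xa]; case: eqP => [->|/eqP ya].
  - by rewrite le_refl.
  - by move=> E; have := fv y; rewrite !inE ya -E ltnn => /(_ yP).
  - by move=> E; have := fv x; rewrite !inE xa E ltnn => /(_ xP).
  - by apply: fchain; rewrite !inE ?xa ?ya.
(* [K] is a chain. An antichain of size [v] outside it would meet chain [i] in a member of [tops],
   which lies below [g i] and hence in [K]. *)
pose K := a |: [set z in P' | (f z == i) && le z (g i)].
have [h [hv hchain]] : exists h, chain_cover le (P :\: K) v.-1 h.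
  apply: IHn => [|Q sQ aQ].
    apply: leq_ltn_trans P'n; apply/subset_leq_card/subsetP=> x.
    by rewrite !inE negb_or => /andP[/andP[-> _] ->].
  have sQP' : Q \subset P'.
    apply: (subset_trans sQ); apply/subsetP=> x.
    by rewrite !inE negb_or => /andP[/andP[-> _] ->].
  have := vP' Q sQP' aQ; rewrite leq_eqVlt => /orP[/eqP Qv|]; last by case: (v).
  have [x xQ fx] := fsurj Q i sQP' aQ Qv (ltn_ord i).
  have := subsetP sQ x xQ; rewrite !inE (negPf (proj1 (setD1P (subsetP sQP' x xQ)))) /=.
  rewrite (proj2 (setD1P (subsetP sQP' x xQ))) fx eqxx /= andbT => /negP[].
  by have [_ _ ->] // := gP i; apply/topsP; exists Q.
have v0 : 0 < v := leq_ltn_trans (leq0n i) (ltn_ord i).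
exists (fun x => if x \in K then v.-1 else h x); split.
  move=> x xP; case: ifP => xK; first by apply: leq_trans vw; rewrite prednK.
  apply: leq_trans (leq_trans (leq_pred _) vw); apply: hv.
  by rewrite inE xK.
have gcmp x : x \in K -> le x a.
  by rewrite !inE => /orP[/eqP->//|/and3P[_ _ /le_trans]]; apply.
have Kch x y : x \in K -> y \in K -> le x y || le y x.
  move=> xK yK; have := xK; rewrite inE => /orP[|].
    by rewrite inE => /eqP->; rewrite gcmp ?orbT.
  rewrite inE => /and3P[xP' /eqP fx _].
  have := yK; rewrite inE => /orP[|]; first by rewrite inE => /eqP->; rewrite gcmp.
  rewrite inE => /and3P[yP' /eqP fy _].
  by apply: fchain; rewrite ?fx ?fy.
move=> x y xP yP; case: ifP => xK; case: ifP => yK.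
- by move=> _; apply: Kch.
- by move=> E; have := hv y; rewrite inE yK -E ltnn => /(_ yP).
- by move=> E; have := hv x; rewrite inE xK E ltnn => /(_ xP).
- by apply: hchain; rewrite inE ?xK ?yK.
Qed.

(** * Relations between finite sets *)

Section FiniteRelations.
Variables I J : finType.
Implicit Types (r s : I -> J -> bool) (A : {set I}) (B : {set J}) (k t : nat).

Definition fib r A b := [set a in A | r a b].

Definition edges r A B := \sum_(b in B) #|fib r A b|.

Definition le_fib r A : rel J := fun b b' => fib r A b \subset fib r A b'.

(** What a semi-equation becomes on finite sets. The bound is strict, so Dilworth's theorem yields
    [k - 1] chains. *)
Definition thin k r A B : Prop :=
  forall a (Q : {set J}), a \in A -> Q \subset B -> (forall b, b \in Q -> r a b) ->
    antichain (le_fib r A) Q -> #|Q| < k.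

Definition nested r A B : Prop :=
  forall b b', b \in B -> b' \in B -> le_fib r A b b' || le_fib r A b' b.

Definition complete r A B : Prop := forall a b, a \in A -> b \in B -> r a b.

Definition Ktt_free_in t r A B : Prop :=
  forall A' B', A' \subset A -> B' \subset B -> complete r A' B' ->
    (#|A'| < t) || (#|B'| < t).

Lemma le_fib_refl r A : reflexive (le_fib r A).
Proof. by move=> b; apply: subxx. Qed.

Lemma le_fib_trans r A : transitive (le_fib r A).
Proof. by move=> b c d; apply: subset_trans. Qed.

Lemma in_fib r A a b : (a \in fib r A b) = (a \in A) && r a b.
Proof. by rewrite inE. Qed.

Lemma le_fibS r A A' b c : A' \subset A -> le_fib r A b c -> le_fib r A' b c.
Proof.
move=> /subsetP s /subsetP h; apply/subsetP=> a; rewrite !in_fib => /andP[aA rab].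
by have := h a; rewrite !in_fib (s _ aA) aA rab => /(_ isT).
Qed.

Lemma leq_fib r A b : #|fib r A b| <= #|A|.
Proof. by apply/subset_leq_card/subsetP=> a; rewrite in_fib => /andP[]. Qed.

Lemma thinS k r A A' B B' :
  A' \subset A -> B' \subset B -> thin k r A B -> thin k r A' B'.
Proof.
move=> sA sB h a Q aA sQ rQ aQ; apply: (h a Q) => //.
- exact: (subsetP sA).
- exact: subset_trans sB.
by move=> b c bQ cQ /(le_fibS sA); apply: aQ.
Qed.

Lemma nestedS r A A' B B' :
  A' \subset A -> B' \subset B -> nested r A B -> nested r A' B'.
Proof.
move=> sA /subsetP sB h b c /sB bB /sB cB.
by have /orP[] := h b c bB cB => /(le_fibS sA)->; rewrite ?orbT.
Qed.

Lemma Ktt_free_inS t r r' A A' B B' :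
  A' \subset A -> B' \subset B -> (forall a b, a \in A' -> b \in B' -> r' a b -> r a b) ->
  Ktt_free_in t r A B -> Ktt_free_in t r' A' B'.
Proof.
move=> sA sB sr h A1 B1 sA1 sB1 c; apply: h.
- exact: subset_trans sA.
- exact: subset_trans sB.
move=> a b aA1 bB1; apply: sr; [exact: (subsetP sA1)|exact: (subsetP sB1)|].
exact: c.
Qed.

Lemma nested_compl r A B : nested r A B -> nested (fun a b => ~~ r a b) A B.
Proof.
move=> h b c bB cB; rewrite orbC.
have /orP[/subsetP s|/subsetP s] := h b c bB cB; apply/orP; [left|right];
apply/subsetP=> a; rewrite !in_fib => /andP[aA]; rewrite aA /=; apply: contraNN => rab;
by have := s a; rewrite !in_fib aA rab => /(_ isT).
Qed.

Lemma nested_thin r A B : nested r A B -> thin 2 r A B.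
Proof.
move=> h a Q aA /subsetP sQ rQ aQ; rewrite ltnS; apply/card_le1P.
move=> b bQ c; rewrite inE; apply/idP/eqP => [cQ|->//].
have /orP[/aQ->//|] := h b c (sQ _ bQ) (sQ _ cQ).
exact: aQ.
Qed.

Lemma edges_pairs r A B : edges r A B = #|[set p in setX A B | r p.1 p.2]|.
Proof.
rewrite /edges -sum1dep_card
  (eq_bigl (fun p => (p.1 \in A) && ((p.2 \in B) && r p.1 p.2))); last first.
  by move=> p; rewrite inE andbA.
rewrite -(pair_big_dep (fun a => a \in A) (fun a b => (b \in B) && r a b) (fun _ _ => 1)) /=.
rewrite (exchange_big_dep (fun b => b \in B)) /=; last by move=> a b _ /andP[].
apply: eq_bigr => b bB; rewrite -sum1dep_card; apply: eq_bigl => a.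
by rewrite bB.
Qed.

Lemma edges_rows r A B : edges r A B = \sum_(a in A) #|[set b in B | r a b]|.
Proof.
rewrite /edges (eq_bigr (fun b => \sum_(a in A | r a b) 1)); last first.
  by move=> b _; rewrite sum1dep_card.
rewrite (exchange_big_dep (fun a => a \in A)) /=; last by move=> b a _ /andP[].
apply: eq_bigr => a aA; rewrite -sum1dep_card; apply: eq_bigl => b.
by rewrite aA.
Qed.

Lemma eq_edges r r' A B :
  (forall a b, a \in A -> b \in B -> r a b = r' a b) -> edges r A B = edges r' A B.
Proof.
move=> h; apply: eq_bigr => b bB; apply: eq_card => a; rewrite !in_fib.
by case aA: (a \in A) => //=; rewrite h.
Qed.

Lemma edges_le r A B : edges r A B <= #|A| * #|B|.
Proof.
rewrite mulnC -sum_nat_const; apply: leq_sum => b _; exact: leq_fib.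
Qed.

Lemma edgesIDl r A A' B :
  edges r A B = edges r (A :&: A') B + edges r (A :\: A') B.
Proof.
rewrite -big_split /=; apply: eq_bigr => b _.
rewrite -(cardsID A' (fib r A b)); congr addn; apply: eq_card => a;
by rewrite !inE; case: (a \in A) => //=; rewrite ?andbF ?andbT // andbC.
Qed.

Lemma edgesIDr r A B B' :
  edges r A B = edges r A (B :&: B') + edges r A (B :\: B').
Proof. exact: big_setID. Qed.

Lemma sum_colors B k (f w : J -> nat) :
  (forall b, b \in B -> f b < k) ->
  \sum_(b in B) w b = \sum_(i < k) \sum_(b in [set b in B | f b == i]) w b.
Proof.
move=> fk; transitivity (\sum_(b in B) \sum_(i < k | f b == i) w b).
  apply: eq_bigr => b bB; rewrite (big_pred1 (Ordinal (fk b bB))) //.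
rewrite (exchange_big_dep predT) //=; apply: eq_bigr => i _.
by apply: eq_bigl => b; rewrite inE.
Qed.

Lemma color_nested k r A B f i :
  chain_cover (le_fib r A) B k f -> nested r A [set b in B | f b == i].
Proof.
move=> [_ fc] b c; rewrite !inE => /andP[bB /eqP fb] /andP[cB /eqP fc'].
by apply: fc; rewrite ?fb.
Qed.

Lemma edges0 r A B : complete (fun a b => ~~ r a b) A B -> edges r A B = 0.
Proof.
move=> c; apply: big1 => b bB; apply/eqP; rewrite cards_eq0; apply/eqP/setP=> a.
by rewrite in_fib inE; apply/negbTE; rewrite negb_and -implybE; apply/implyP=> /c; apply.
Qed.

Lemma thin_cover k r A B a :
  thin k r A B -> a \in A -> (forall b, b \in B -> r a b) ->
  exists f, chain_cover (le_fib r A) B k.-1 f.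
Proof.
move=> th aA rB; apply: dilworth; first exact: le_fib_refl.
  exact: le_fib_trans.
move=> Q sQ aQ; have := th a Q aA sQ _ aQ.
move/(_ (fun b bQ => rB b (subsetP sQ b bQ))); by case: k {th}.
Qed.

Lemma chain_cover_sum k r A B (w : J -> nat) u f :
  chain_cover (le_fib r A) B k f ->
  (forall B', B' \subset B -> nested r A B' -> \sum_(b in B') w b <= u) ->
  \sum_(b in B) w b <= k * u.
Proof.
move=> fc ws; rewrite (sum_colors w fc.1).
rewrite -[k in k * u]card_ord -sum_nat_const; apply: leq_sum => i _; apply: ws.
  by apply/subsetP=> b; rewrite inE => /andP[].
exact: color_nested fc.
Qed.

Lemma chain_cover_card k r A B u f :
  chain_cover (le_fib r A) B k f ->
  (forall B', B' \subset B -> nested r A B' -> #|B'| <= u) ->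
  #|B| <= k * u.
Proof.
move=> fc h; rewrite -sum1_card; apply: chain_cover_sum fc _ => B' sB nB.
by rewrite sum1_card; apply: h.
Qed.

Lemma nested_bottom r A B : nested r A B -> B != set0 ->
  exists2 b0, b0 \in B & forall b, b \in B -> le_fib r A b0 b.
Proof.
move=> nB /set0Pn[b1 b1B].
have [b0 b0B bmin] := @arg_minnP _ b1 (mem B) (fun b => #|fib r A b|) b1B.
exists b0 => // b bB; have /orP[//|] := nB b0 b b0B bB.
rewrite /le_fib => sb; have /eqP -> // : fib r A b == fib r A b0.
by rewrite eqEcard sb bmin.
Qed.

Lemma nested_top r A B : nested r A B -> B != set0 ->
  exists2 b0, b0 \in B & forall b, b \in B -> le_fib r A b b0.
Proof.
move=> nB /set0Pn[b1 b1B].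
have [b0 b0B bmax] := @arg_maxnP _ b1 (mem B) (fun b => #|fib r A b|) b1B.
exists b0 => // b bB; have /orP[//|] := nB b b0 bB b0B.
rewrite /le_fib => sb; have /eqP -> // : fib r A b0 == fib r A b.
by rewrite eqEcard sb; apply: bmax.
Qed.

Lemma sub_card (T : finType) (P : {set T}) n : n <= #|P| ->
  exists2 Q : {set T}, Q \subset P & #|Q| = n.
Proof.
move=> /card_geqP[q [uq <- sq]]; exists [set x in q].
  by apply/subsetP=> x; rewrite inE => /sq.
by rewrite cardsE; apply/card_uniqP.
Qed.

(** The smallest fibre has at least [t] points and lies in all the others, so together with [B] it
    spans a complete bipartite subrelation. *)
Lemma Ktt_free_nested t r A B : Ktt_free_in t r A B -> nested r A B ->
  (forall b, b \in B -> t <= #|fib r A b|) -> #|B| <= t.-1.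
Proof.
move=> K nB tB; have [->|B0] := eqVneq B set0; first by rewrite cards0.
have [b0 b0B bmin] := nested_bottom nB B0.
have : (#|fib r A b0| < t) || (#|B| < t).
  apply: K => //; first by apply/subsetP=> a; rewrite in_fib => /andP[].
  move=> a b ab0 bB; have := subsetP (bmin b bB) a ab0.
  by rewrite in_fib => /andP[].
by rewrite ltnNge tB //=; case: t {K tB}.
Qed.

(** Fibres with fewer than [t] points give the term in [#|B|]. Among the other [b], those related to
    a fixed [a] form [k - 1] chains, each with at most [t - 1] members. *)
Lemma edges_thin t k r A B : thin k r A B -> Ktt_free_in t r A B ->
  edges r A B <= k.-1 * t.-1 * #|A| + t.-1 * #|B|.
Proof.
move=> th K; pose B1 := [set b in B | t <= #|fib r A b|].
have sB1 : B1 \subset B by apply/subsetP=> b; rewrite inE => /andP[].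
rewrite (edgesIDr r A B B1); apply: leq_add.
  have -> : B :&: B1 = B1 by apply/setIidPr.
  rewrite edges_rows mulnC -sum_nat_const; apply: leq_sum => a aA.
  have [||f fc] := @thin_cover k r A [set b in B1 | r a b] a _ aA.
  - apply: thinS th => //; apply: subset_trans sB1.
    by apply/subsetP=> b; rewrite inE => /andP[].
  - by move=> b; rewrite inE => /andP[].
  apply: chain_cover_card fc _ => B' sB' nB'.
  have sB'1 : B' \subset B1.
    by apply: (subset_trans sB'); apply/subsetP=> b; rewrite inE => /andP[].
  apply: (@Ktt_free_nested t r A) => //.
    by apply: Ktt_free_inS K => //; apply: subset_trans sB1.
  by move=> b /(subsetP sB'1); rewrite inE => /andP[].
apply: (@leq_trans (\sum_(b in B :\: B1) t.-1)).
  apply: leq_sum => b; rewrite !inE negb_and => /andP[+ bB]; rewrite bB /= -ltnNge.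
  by case: t {K B1 sB1}.
by rewrite sum_nat_const mulnC leq_mul2l subset_leq_card ?orbT ?subsetDl.
Qed.

Lemma edges_nested t r A B : nested r A B -> Ktt_free_in t r A B ->
  edges r A B <= t.-1 * (#|A| + #|B|).
Proof.
by move=> /nested_thin th /(edges_thin th); rewrite mul1n mulnDr.
Qed.

End FiniteRelations.

(** * Heavy chains for conjunctions of negative literals *)

Section NegativeStep.
Variables I J : finType.
Implicit Types (A : {set I}) (B : {set J}) (k t : nat).

Lemma card_bigcup_le (T K : finType) (P : pred K) (E : K -> {set T}) :
  #|\bigcup_(i | P i) E i| <= \sum_(i | P i) #|E i|.
Proof.
elim/big_rec2: _ => [|i n X _ h]; first by rewrite cards0.
by apply: leq_trans (leq_card_setU _ _).1 _; rewrite leq_add2l.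
Qed.

(* All but [t - 1] of the [b] have large complementary sets [fib (s j) A b]: if these
   were small for [t] values of [b], a [t]-subset of [A] would avoid all of them.
   Weighting [b] by its degree, a chain of maximal weight for one of the [s j] thus
   carries a proportion [1 / (t d k)] of all edges. *)
Lemma heavy_chain d k t (s : 'I_d.+1 -> I -> J -> bool) r A B :
  (forall a b, r a b = [forall j, ~~ s j a b]) ->
  (forall j, thin k (s j) A B) -> 0 < t -> 0 < k -> Ktt_free_in t r A B ->
  k * t <= #|A| ->
  exists j B', [/\ B' \subset B, nested (s j) A B' &
    edges r A B <= t.-1 * #|A| + t * d.+1 * k * edges r A B'].
Proof.
move=> rE th t0 k0 K ktA.
(* Boolean form of the conditions on [j] and [B'], so that the maximum runs over the chains of all
   literals at once. *)
pose ok (q : 'I_d.+1 * {set J}) :=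
  (q.2 \subset B) && [forall b in q.2, forall c in q.2,
                        le_fib (s q.1) A b c || le_fib (s q.1) A c b].
have okP j B' : reflect (B' \subset B /\ nested (s j) A B') (ok (j, B')).
  apply: (iffP andP) => -[sB h]; split=> //.
    by move=> b c bB cB; have /forall_inP/(_ b bB)/forall_inP/(_ c cB) := h.
  by apply/forall_inP=> b bB; apply/forall_inP=> c cB; apply: h.
have ok0 : ok (ord0, set0).
  by apply/okP; split=> [|b]; rewrite ?sub0set ?inE.
have [[j C] /okP[sC nC] Cmax] := @arg_maxnP _ _ ok (fun q => edges r A q.2) ok0.
exists j, C; split=> //; rewrite /= in Cmax.
set u := edges r A C.
have umax i B' : B' \subset B -> nested (s i) A B' -> edges r A B' <= u.
  by move=> sB nB; apply: (Cmax (i, B')); apply/okP.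
pose m := #|A|; pose w b := #|fib r A b|.
pose bad := [set b in B | t * \sum_i #|fib (s i) A b| <= m - t].
have tm : t <= m by apply: leq_trans ktA; rewrite leq_pmull.
(* The complementary sets of [t] bad values would cover at most [m - t] points, and the remaining
   points would give a [K_{t,t}]. *)
have bad_lt : #|bad| < t.
  rewrite ltnNge; apply/negP => /sub_card[B' sB' B't].
  pose A' := A :\: \bigcup_(b in B') \bigcup_i fib (s i) A b.
  have : (#|A'| < t) || (#|B'| < t).
    apply: K; first exact: subsetDl.
      by apply: (subset_trans sB'); apply/subsetP=> b; rewrite inE => /andP[].
    move=> a b /setDP[aA nU] bB'; rewrite rE; apply/forallP=> i.
    apply: contraNN nU => sab; apply/bigcupP; exists b => //.
    by apply/bigcupP; exists i => //; rewrite in_fib aA.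
  rewrite B't ltnn orbF ltnNge => /negP; apply.
  have cU : #|\bigcup_(b in B') \bigcup_i fib (s i) A b| <= m - t.
    apply: leq_trans (card_bigcup_le _ _) _.
    apply: leq_trans (leq_sum _ (fun b _ => card_bigcup_le _ _)) _.
    rewrite -(leq_pmul2l t0) big_distrr /= -{2}B't -sum_nat_const.
    by apply: leq_sum => b /(subsetP sB'); rewrite inE => /andP[].
  by have := cardsD A (\bigcup_(b in B') \bigcup_i fib (s i) A b);
     have := subset_leq_card (subsetIr A (\bigcup_(b in B') \bigcup_i fib (s i) A b));
     rewrite /A' -/m; lia.
have wa i a : a \in A -> \sum_(b in [set b in B | s i a b]) w b <= k.-1 * u.
  move=> aA; have sB : [set b in B | s i a b] \subset B.
    by apply/subsetP=> b; rewrite inE => /andP[].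
  have [||f fc] := @thin_cover _ _ k (s i) A [set b in B | s i a b] a _ aA.
  - exact: thinS (th i).
  - by move=> b; rewrite inE => /andP[].
  apply: chain_cover_sum fc _ => B' sB' nB'; apply: umax nB'.
  exact: subset_trans sB.
(* Double counting of the triples [(i, a, b)] with [s i a b], weighted by the degree of [b]: for
   fixed [i] and [a] these [b] form at most [k - 1] chains, each of weight at most [u]. *)
have wB : \sum_(b in B) w b * \sum_i #|fib (s i) A b| <= d.+1 * (m * (k.-1 * u)).
  under eq_bigr => b _ do rewrite big_distrr /=.
  rewrite exchange_big /= -[X in _ <= X * _]card_ord -sum_nat_const; apply: leq_sum => i _.
  rewrite -sum_nat_const.
  under eq_bigr => b _ do rewrite -sum1_card big_distrr /=.
  rewrite (exchange_big_dep (fun a => a \in A)) /=; last by move=> b a _; rewrite in_fib => /andP[].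
  apply: leq_sum => a aA; apply: leq_trans (wa i a aA).
  rewrite leq_eqVlt; apply/orP; left; apply/eqP.
  by apply: eq_big => [b|b _]; rewrite ?muln1 // !inE aA.
rewrite (edgesIDr r A B bad); apply: leq_add.
  apply: leq_trans (edges_le _ _ _) _; rewrite mulnC leq_mul2r.
  apply/orP; right; apply: leq_trans (subset_leq_card (subsetIr _ _)) _.
  by rewrite -ltnS prednK.
(* A value [b] that is not bad has total complementary size at least [(m - t + 1) / t]; this is
   compared with [wB]. *)
have mt0 : 0 < (m - t).+1 by [].
rewrite -(leq_pmul2r mt0).
apply: (@leq_trans (t * (d.+1 * (m * (k.-1 * u))))).
  apply: leq_trans (leq_mul (leqnn t) wB).
  rewrite /edges big_distrl big_distrr /=.
  rewrite [X in _ <= X](big_setID bad) /=; apply: leq_trans (leq_addl _ _).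
  apply: leq_sum => b; rewrite !inE negb_and => /andP[+ bB].
  by rewrite bB /= -ltnNge mulnCA => h; rewrite leq_mul2l h orbT.
(* The right side exceeds the left by [m - k t + k]; this is where [k * t <= #|A|] enters. *)
have : m * k.-1 <= k * (m - t).+1.
  move: ktA tm k0; rewrite -/m; clear; case: k => // k; nia.
move=> h; rewrite -/u -!mulnA leq_mul2l; apply/orP; right.
rewrite leq_mul2l; apply/orP; right.
by rewrite !mulnA [k * u * _]mulnAC leq_mul2r h orbT.
Qed.

End NegativeStep.

(** * Clusters above minimal fibres, and initial parts of a chain *)

Section Clusters.
Variables I J : finType.
Implicit Types (s : I -> J -> bool) (A : {set I}) (B : {set J}) (k q : nat).

(** A dominating subset of least cardinality is an antichain: of two comparable members the upper
    one could be dropped. *)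
Lemma dominating_antichain (T : finType) (le : rel T) (B : {set T}) :
  reflexive le -> transitive le ->
  exists M : {set T}, [/\ M \subset B, antichain le M &
    forall b, b \in B -> exists2 mu, mu \in M & le mu b].
Proof.
move=> le_refl le_trans.
pose dom (M : {set T}) := (M \subset B) && [forall b in B, exists mu in M, le mu b].
have domB : dom B.
  by rewrite /dom subxx; apply/forall_inP=> b bB; apply/exists_inP; exists b.
have [M /andP[sM /forall_inP dM] Mmin] := arg_minnP (fun M : {set T} => #|M|) domB.
exists M; split=> // [x y xM yM xy|b /dM/exists_inP//].
apply/eqP/negPn/negP => xNy.
have : dom (M :\ y).
  rewrite /dom (subset_trans (subsetDl _ _) sM); apply/forall_inP=> b bB.
  have /exists_inP[mu muM mub] := dM b bB; apply/exists_inP.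
  have [muy|muNy] := eqVneq mu y; last by exists mu; rewrite // !inE muNy.
  exists x; first by rewrite !inE xNy.
  by apply: le_trans xy _; rewrite -muy.
by move/Mmin; rewrite leqNgt (cardsD1 y M) yM ltnS leqnn.
Qed.

(* If the sets [fib s A b] through [a] belong to many clusters, then those of a
   chain among them contain many members of the antichain [M], each of at least
   half the size of the top of the chain; so some point lies in [k] members of [M]. *)
Lemma clusters k s A B q : thin k s A B -> 0 < q ->
  (forall b, b \in B -> q <= #|fib s A b| < 2 * q) ->
  exists (M : {set J}) (g : J -> J),
    [/\ M \subset B, forall b, b \in B -> g b \in M,
        forall b, b \in B -> le_fib s A (g b) b &
        forall a, a \in A ->
          #|[set mu in M | [exists b in B, (g b == mu) && s a b]]|
            <= k.-1 * (2 * k.-1)].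
Proof.
move=> th q0 sz.
have [M [sM aM dM]] :=
  dominating_antichain B (@le_fib_refl _ _ s A) (@le_fib_trans _ _ s A).
have dM' b : exists mu, (b \in B) ==> (mu \in M) && le_fib s A mu b.
  by case bB: (b \in B); [have [mu muM mub] := dM b bB; exists mu; rewrite muM|exists b].
pose g b := xchoose (dM' b).
have gP b : b \in B -> (g b \in M) && le_fib s A (g b) b.
  by move=> bB; have /implyP/(_ bB) := xchooseP (dM' b).
exists M, g; split=> // [b /gP/andP[]//|b /gP/andP[]//|a aA].
set N := [set _ in M | _].
have hP mu : exists b, (mu \in N) ==> [&& b \in B, g b == mu & s a b].
  case muN: (mu \in N); last by exists mu.
  move: muN; rewrite inE => /andP[_ /exists_inP[b bB /andP[gb sab]]].
  by exists b; rewrite bB gb sab.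
(* One representative through [a] is taken from each cluster that [a] meets; the representatives
   split into [k - 1] chains. *)
pose h mu := xchoose (hP mu).
have hN mu : mu \in N -> [/\ h mu \in B, g (h mu) = mu & s a (h mu)].
  by move=> muN; have /implyP/(_ muN)/and3P[? /eqP ? ?] := xchooseP (hP mu).
have hinj : {in N &, injective h}.
  by move=> x y /hN[_ gx _] /hN[_ gy _] E; rewrite -gx E.
rewrite -(card_in_imset hinj).
have [||f fc] := @thin_cover _ _ k s A (h @: N) a _ aA.
- apply: thinS th => //; apply/subsetP=> _ /imsetP[mu /hN[hB _ _] ->] //.
- by move=> _ /imsetP[mu /hN[_ _ shb] ->].
apply: chain_cover_card fc _ => C sC nC.
have [->|C0] := eqVneq C set0; first by rewrite cards0.
have [top topC topP] := nested_top nC C0.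
have CB b : b \in C -> [/\ b \in B & g b \in M].
  by move=> /(subsetP sC)/imsetP[mu /hN[hB _ _] ->]; split=> //; have /andP[] := gP _ hB.
have ginj : {in C &, injective g}.
  move=> x y /(subsetP sC)/imsetP[mu /hN[_ gx _] ->] /(subsetP sC)/imsetP[nu /hN[_ gy _] ->].
  by rewrite gx gy => ->.
have [topB _] := CB _ topC.
rewrite -(leq_pmul2r q0) -mulnA [k.-1 * _]mulnC mulnA.
(* Incidences between the points of the top fibre and the members of [M] under the chain are counted
   twice: each member has at least [q] points, all of them in the top fibre, which has fewer than
   [2 q] points, and each point lies in at most [k - 1] members. *)
apply: (@leq_trans (\sum_(mu in g @: C) #|fib s (fib s A top) mu|)).
  rewrite big_imset //= -sum_nat_const; apply: leq_sum => b bC.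
  have [bB gbM] := CB _ bC; have /andP[_ gbb] := gP _ bB.
  have /andP[szg _] := sz _ (subsetP sM _ gbM).
  apply: leq_trans szg _; apply/subset_leq_card/subsetP=> x xg.
  rewrite in_fib (subsetP (topP b bC)) ?(subsetP gbb) //.
  by move: xg; rewrite in_fib => /andP[].
rewrite -[X in X <= _]/(edges s _ _) edges_rows.
have /andP[_ sztop] := sz _ topB.
apply: leq_trans (leq_mul (ltnW sztop) (leqnn _)); rewrite -sum_nat_const.
apply: leq_sum => x; rewrite in_fib => /andP[xA _].
rewrite -ltnS; apply: leq_trans (leqSpred k); apply: (th x) => //.
- apply/subsetP=> mu; rewrite inE => /andP[/imsetP[b bC ->] _].
  by have [_ /(subsetP sM)] := CB _ bC.
- by move=> b; rewrite inE => /andP[].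
apply: antichainS aM; apply/subsetP=> mu; rewrite inE => /andP[/imsetP[b bC ->] _].
by have [] := CB _ bC.
Qed.

(** Makes halving along a chain possible. Points are taken greedily by the number of fibres through
    them, since in a nested family each fibre prefers the points of larger count. *)
Lemma nested_prefix s A B n : nested s A B -> n <= #|A| ->
  exists A1 : {set I}, [/\ A1 \subset A, #|A1| = n &
    forall b, b \in B -> (fib s A b \subset A1) || (A1 \subset fib s A b)].
Proof.
move=> nB; elim: n => [|n IHn] nA.
  by exists set0; rewrite sub0set cards0; split=> // b _; rewrite sub0set orbT.
have [A1 [sA1 A1n cmp]] := IHn (ltnW nA).
have [a0 a0A] : exists a, a \in A :\: A1.
  apply/set0Pn; rewrite -card_gt0 cardsD (setIidPr sA1) A1n subn_gt0 //.
have [a aA amax] := @arg_maxnP _ a0 (mem (A :\: A1)) (fun a => #|[set b in B | s a b]|) a0A.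
have /setDP[aA' aA1] : a \in A :\: A1 := aA.
exists (a |: A1); split.
- by apply/subsetP=> x /setU1P[->|/(subsetP sA1)].
- by rewrite cardsU1 aA1 A1n.
move=> b bB; have /orP[sb|sb] := cmp b bB; first by rewrite (subset_trans sb) ?subsetUr.
have [/subsetP sb'|/subsetPn[a' a'b a'A1]] := boolP (fib s A b \subset A1).
  by apply/orP; left; apply/subsetP=> x /sb' xA; rewrite !inE xA orbT.
apply/orP; right; apply/subsetP=> x /setU1P[->|/(subsetP sb)//].
rewrite in_fib aA' /=; apply/negPn/negP => nsab.
move: a'b; rewrite in_fib => /andP[a'A sa'b].
(* If the fibre of [b] contains [a'] but not [a], nestedness puts [a'] into every fibre containing
   [a], so [a'] lies in strictly more fibres than [a]. *)
have := amax a'; rewrite /geq /= inE a'A1 a'A => /(_ isT).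
rewrite leqNgt => /negP; apply; apply/proper_card/properP; split.
  apply/subsetP=> c; rewrite !inE => /andP[cB sac]; rewrite cB /=.
  have /orP[/subsetP/(_ a')|/subsetP/(_ a)] := nB b c bB cB; rewrite !in_fib.
    by rewrite a'A sa'b => /(_ isT).
  by rewrite aA' sac (negPf nsab) => /(_ isT).
by exists b; rewrite !inE bB ?sa'b // (negPf nsab).
Qed.

End Clusters.

From mathcomp Require Import all_order all_algebra.
From mathcomp Require Import all_classical all_reals all_analysis.
From mathcomp Require Import ring lra.

Import Order.TTheory GRing.Theory Num.Theory.
Local Open Scope ring_scope.

(** * Estimates for logarithms *)

Section Logarithms.
Variable F : realType.

Lemma ln_nat_ge0 (m : nat) : 0 <= ln m.+1%:R :> F.
Proof. by apply: ln_ge0; rewrite ler1n. Qed.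

Lemma ler_ln_nat (m n : nat) : (m <= n)%N -> ln m.+1%:R <= ln n.+1%:R :> F.
Proof. by move=> mn; rewrite ler_ln ?posrE ?ltr0n // ler_nat. Qed.

(** Even when the half is rounded up, the ratio of the arguments is at most [3/4], with equality for
    [m = 3] and [n = 2]; then [ln x <= x - 1] applies. This is the source of the factor 4 paid for
    each halving recursion. *)
Lemma ln_half (m n : nat) : (1 < m)%N -> (n <= m - m./2)%N ->
  1 <= 4 * (ln m.+1%:R - ln n.+1%:R) :> F.
Proof.
move=> m1 nm.
have m0 : 0 < m.+1%:R :> F by rewrite ltr0n.
have n0 : 0 < n.+1%:R :> F by rewrite ltr0n.
rewrite -ln_div ?posrE //.
have h : ln (1 + (n.+1%:R / m.+1%:R - 1)) <= n.+1%:R / m.+1%:R - 1 :> F.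
  by apply: le_ln1Dx; rewrite ltrBrDr addrC subrr divr_gt0.
have E : n.+1%:R / m.+1%:R <= 3/4 :> F.
  rewrite ler_pdivrMr //.
  have : (4 * n.+1 <= 3 * m.+1)%N by have := odd_double_half m; lia.
  rewrite -(ler_nat F) !natrM; move=> ?; lra.
have -> : ln (m.+1%:R / n.+1%:R) = - ln (n.+1%:R / m.+1%:R) :> F.
  by rewrite -lnV ?posrE ?divr_gt0 // invf_div.
move: h E; rewrite addrC subrK.
move: (n.+1%:R / m.+1%:R) => q h E; move: (ln q) h => l h; lra.
Qed.

Lemma ln2_half : 1 <= 2 * ln 2%:R :> F.
Proof.
have h : ln (1 + (2%:R^-1 - 1)) <= 2%:R^-1 - 1 :> F.
  by apply: le_ln1Dx; lra.
by move: h; rewrite addrC subrK lnV ?posrE ?ltr0n // => h; lra.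
Qed.

Lemma ln_nat_half (m : nat) : (0 < m)%N -> 1 <= 2 * ln m.+1%:R :> F.
Proof.
move=> m0; apply: le_trans ln2_half _; rewrite ler_pM2l ?ltr0n //.
exact: (@ler_ln_nat 1).
Qed.

(** Bounds the number of dyadic levels. With [l = trunc_log 2 m] one has
    [2 ^ (l + 1) <= 2 m <= (m + 1) ^ 2], and [ln 2 >= 1/2]. *)
Lemma trunc_log_ln (m : nat) : (0 < m)%N -> (trunc_log 2 m).+1%:R <= 4 * ln m.+1%:R :> F.
Proof.
move=> m0.
have h : (2 ^ (trunc_log 2 m).+1 <= m.+1 ^ 2)%N.
  by rewrite expnS; have := trunc_logP (isT : 1 < 2)%N m0; rewrite -mulnn; nia.
have : ln ((2 ^ (trunc_log 2 m).+1)%:R) <= ln ((m.+1 ^ 2)%:R) :> F.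
  by rewrite ler_ln ?posrE ?ltr0n ?expn_gt0 // ler_nat.
rewrite !natrX !lnXn ?ltr0n // -[X in X <= _]mulr_natl -[X in _ <= X]mulr_natl.
have := ln2_half; have : 0 <= (trunc_log 2 m).+1%:R :> F by rewrite ler0n.
move: (ln _) (ln _) ((_.+1)%:R) => x y z ? ? ?; nra.
Qed.

End Logarithms.

(** * Removing one literal *)

Section Bicliques.
Variables (F : realType) (I J : finType).
Implicit Types (r s : I -> J -> bool) (A : {set I}) (B : {set J}) (k t : nat).

(** On a rectangle inside [s] the literal [s] holds everywhere, so this is what an induction
    hypothesis on the remaining literals provides. *)
Definition biclique_bound r s A B (c : F) : Prop :=
  forall A' B', A' \subset A -> B' \subset B -> complete s A' B' ->
    (edges r A' B')%:R <= c * (#|A'| + #|B'|)%:R.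

Lemma biclique_boundS r s A A' B B' c : A' \subset A -> B' \subset B ->
  biclique_bound r s A B c -> biclique_bound r s A' B' c.
Proof.
move=> sA sB h A1 B1 sA1 sB1; apply: h.
- exact: fintype.subset_trans sA.
- exact: fintype.subset_trans sB.
Qed.

(** [A] is halved into [A1] and [A2'] along the chain, and [B1] collects the fibres inside [A1].
    Then [A2'] and [B1] span no edge, [A1] and [B :\: B1] span a biclique, and the two remaining
    rectangles are disjoint in both coordinates and handled by recursion. *)
Lemma edges_nested_biclique r s A B c : 0 <= c -> nested s A B ->
  (forall a b, r a b -> s a b) -> biclique_bound r s A B c ->
  (edges r A B)%:R <= 4 * ln #|A|.+1%:R * c * (#|A| + #|B|)%:R.
Proof.
move=> c0 + rs; have [n] := ubnP #|A|; elim: n A B => // n IHn A B.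
rewrite ltnS => An nB Hc.
have [A0|A0] := posnP #|A|.
  have -> : edges r A B = 0%N by have := edges_le r A B; rewrite A0; lia.
  by rewrite !mulr_ge0 ?ln_nat_ge0.
(* A single point cannot be halved; together with the [b] of nonempty fibre it is already a
   biclique. *)
have [A1|A2] := leqP #|A| 1.
  pose B' := [set b in B | (0 < #|fib s A b|)%N].
  have sB' : B' \subset B by apply/fintype.subsetP=> b; rewrite inE => /andP[].
  have cB' : complete s A B'.
    move=> a b aA; rewrite inE => /andP[bB /card_gt0P[a']].
    rewrite in_fib => /andP[a'A]; have /card_le1P/(_ a aA a') := A1.
    by rewrite a'A inE => /esym/eqP->.
  rewrite (edgesIDr r A B B') (finset.setIidPr sB') [X in (_ + X)%N]edges0; last first.
    move=> a b aA; rewrite !inE negb_and => /andP[+ bB].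
    rewrite bB /= -eqn0Ngt cards_eq0 => /eqP f0.
    apply/negP => /rs sab; have : a \in fib s A b by rewrite in_fib aA.
    by rewrite f0 inE.
  rewrite addn0; apply: le_trans (Hc _ _ _ sB' cB') _ => //.
  have h1 := ln_nat_half F A0.
  have h2 : (#|A| + #|B'|)%:R <= (#|A| + #|B|)%:R :> F.
    by rewrite ler_nat leq_add2l subset_leq_card.
  rewrite -[X in _ <= X]mulrA.
  have h3 : 0 <= (#|A| + #|B'|)%:R :> F by rewrite ler0n.
  move: (ln _) ((_ + #|B'|)%:R) ((_ + #|B|)%:R) h1 h2 h3 => x y z h1 h2 h3.
  have : c * y <= c * z by rewrite ler_wpM2l.
  have : 0 <= c * z by rewrite mulr_ge0 // (le_trans h3).
  move: (c * y) (c * z) => u v v0 uv; have := ler_wpM2r v0 h1.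
  by rewrite mul1r => ?; lra.
have hm : (#|A|./2 <= #|A|)%N by have := odd_double_half #|A|; lia.
have [A1 [sA1 A1m cmp]] := nested_prefix nB hm.
set A2' := A :\: A1.
have A2m : #|A2'| = (#|A| - #|A|./2)%N by rewrite cardsD (finset.setIidPr sA1) A1m.
pose B1 := [set b in B | fib s A b \subset A1].
have sB1 : B1 \subset B by apply/fintype.subsetP=> b; rewrite inE => /andP[].
have sA2 : A2' \subset A by apply: finset.subsetDl.
have sB2 : B :\: B1 \subset B by apply: finset.subsetDl.
have E21 : edges r A2' B1 = 0%N.
  apply: edges0 => a b; rewrite !inE => /andP[aA1 aA] /andP[bB /fintype.subsetP sb].
  apply/negP => /rs sab; case/negP: aA1; apply: sb; by rewrite in_fib aA.
have c12 : complete s A1 (B :\: B1).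
  move=> a b aA1; rewrite !inE negb_and => /andP[+ bB]; rewrite bB /= => /negPf nb.
  by have := cmp b bB; rewrite nb => /fintype.subsetP/(_ a aA1); rewrite in_fib => /andP[].
have -> : edges r A B = (edges r A1 (B :\: B1) + edges r A1 B1 + edges r A2' (B :\: B1))%N.
  rewrite (edgesIDr r A B B1) (finset.setIidPr sB1).
  rewrite (edgesIDl r A A1 B1) (edgesIDl r A A1 (B :\: B1)) (finset.setIidPr sA1) E21.
  by rewrite -/A2'; lia.
rewrite !natrD.
have H0 := Hc _ _ sA1 sB2 c12.
have half_pos : (0 < #|A|./2)%N by have := odd_double_half #|A|; clear -A2; lia.
have H1 := IHn A1 B1 _ (nestedS sA1 sB1 nB) (biclique_boundS sA1 sB1 Hc).
have H2 := IHn A2' (B :\: B1) _ (nestedS sA2 sB2 nB) (biclique_boundS sA2 sB2 Hc).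
have {}H1 := H1 ltac:(rewrite A1m; clear -A2 An half_pos; lia).
have {}H2 := H2 ltac:(rewrite A2m; clear -A2 An half_pos; lia).
have L1 : 1 <= 4 * (ln #|A|.+1%:R - ln #|A1|.+1%:R) :> F.
  by apply: ln_half => //; rewrite A1m; have := odd_double_half #|A|; clear; lia.
have L2 : 1 <= 4 * (ln #|A|.+1%:R - ln #|A2'|.+1%:R) :> F.
  by apply: ln_half => //; rewrite A2m.
have cA : #|A| = (#|A1| + #|A2'|)%N by rewrite A1m A2m subnKC.
have cB : #|B| = (#|B1| + #|B :\: B1|)%N by rewrite -(cardsID B1 B) (finset.setIidPr sB1).
have S : #|A|%:R + #|B|%:R = #|A1|%:R + #|A2'|%:R + #|B1|%:R + #|B :\: B1|%:R :> F.
  by rewrite {1}cA cB !natrD; ring.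
rewrite S; move: H0 H1 H2 L1 L2; rewrite !natrD.
have := ler0n F #|A1|; have := ler0n F #|A2'|.
have := ler0n F #|B1|; have := ler0n F #|B :\: B1|.
have := ln_nat_ge0 F #|A1|; have := ln_nat_ge0 F #|A2'|.
move: (ln #|A|.+1%:R) (ln #|A1|.+1%:R) (ln #|A2'|.+1%:R) => l l1 l2.
move: (edges _ _ _)%:R (edges _ _ _)%:R (edges _ _ _)%:R => e0 e1 e2.
move: (#|A1|%:R) (#|A2'|%:R) (#|B1|%:R) (#|B :\: B1|%:R) => a1 a2 b1 b2.
move=> l2p l1p b2p b1p a2p a1p H0 H1 H2 L1 L2.
(* Since [4 l1 <= 4 l - 1] and [4 l2 <= 4 l - 1], the recursive terms leave [c] times the total size
   unspent, enough to pay for the biclique. *)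
have X1 : 4 * l1 * c * (a1 + b1) <= (4 * l - 1) * (c * (a1 + b1)).
  rewrite -[4 * l1 * c * _]mulrA; apply: ler_wpM2r; last lra.
  by rewrite mulr_ge0 // addr_ge0.
have X2 : 4 * l2 * c * (a2 + b2) <= (4 * l - 1) * (c * (a2 + b2)).
  rewrite -[4 * l2 * c * _]mulrA; apply: ler_wpM2r; last lra.
  by rewrite mulr_ge0 // addr_ge0.
have := mulr_ge0 c0 a2p; have := mulr_ge0 c0 b1p.
have -> : 4 * l * c * (a1 + a2 + b1 + b2) =
  (4 * l - 1) * (c * (a1 + b1)) + (4 * l - 1) * (c * (a2 + b2)) + (c * (a1 + b2) + c * a2 + c * b1).
  ring.
lra.
Qed.

(** Only the constant term is paid once per chain; the terms linear in [#|B'|] add up over the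
    partition. *)
Lemma sum_edges_cover k r s A B (f : J -> nat) (b0 : F) (b1 : F) :
  chain_cover (le_fib s A) B k f ->
  (forall B', B' \subset B -> nested s A B' ->
     (edges r A B')%:R <= b0 + b1 * #|B'|%:R) ->
  (edges r A B)%:R <= k%:R * b0 + b1 * #|B|%:R.
Proof.
move=> fc h; rewrite /edges (sum_colors (fun b => #|fib r A b|) fc.1).
have -> : #|B| = (\sum_(i < k) #|[set b in B | f b == i]|)%N.
  rewrite -sum1_card (sum_colors (fun=> 1%N) fc.1).
  by apply: eq_bigr => i _; rewrite sum1_card.
rewrite !natr_sum mulr_sumr -[k in k%:R * b0]card_ord mulr_natl -sumr_const -big_split.
apply: ler_sum => i _; apply: h; last exact: color_nested fc.
by apply/fintype.subsetP=> b; rewrite inE => /andP[].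
Qed.

(** The common point [a] makes all fibres split into [k - 1] chains. These are chains in [A] and
    stay chains in [A'], the part of [A] that a cluster meets, so the factor [k - 1] falls on
    [#|A'|] alone. *)
Lemma edges_thin_common k r s A A' B a c : 0 <= c -> thin k s A B -> a \in A ->
  (forall b, b \in B -> s a b) -> A' \subset A ->
  (forall a b, r a b -> s a b) -> biclique_bound r s A B c ->
  (edges r A' B)%:R <= 4 * ln #|A|.+1%:R * c * (k.-1%:R * #|A'|%:R + #|B|%:R).
Proof.
move=> c0 th aA sB sA' rs Hc.
have [f [fk fc]] := thin_cover th aA sB.
have fc' : chain_cover (le_fib s A') B k.-1 f.
  split=> // b b' bB b'B E; have /orP[] := fc b b' bB b'B E;
  by move=> /(le_fibS sA') ->; rewrite ?orbT.
pose L : F := 4 * ln #|A|.+1%:R * c.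
have L0 : 0 <= L by rewrite !mulr_ge0 ?ln_nat_ge0.
rewrite mulrDr mulrCA -/L; apply: sum_edges_cover fc' _ => B' sB' nB'.
apply: le_trans (edges_nested_biclique c0 nB' rs (biclique_boundS sA' sB' Hc)) _.
rewrite natrD mulrDr; apply: lerD; rewrite ler_wpM2r // ler_wpM2r // ler_wpM2l //;
by rewrite ler_ln_nat // subset_leq_card.
Qed.

(** All members of a cluster contain its minimal fibre, which is nonempty. The clusters partition
    [B], while their supports cover each [a] at most [2 (k - 1) ^ 2] times; with the [k - 1] chains
    per cluster this gives the cube. *)
Lemma edges_level k q r s A B c : 0 <= c -> thin k s A B -> (0 < q)%N ->
  (forall b, b \in B -> q <= #|fib s A b| < 2 * q)%N ->
  (forall a b, r a b -> s a b) -> biclique_bound r s A B c ->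
  (edges r A B)%:R <=
    4 * ln #|A|.+1%:R * c * (2 * k.-1%:R ^+ 3 * #|A|%:R + #|B|%:R).
Proof.
move=> c0 th q0 sz rs Hc.
have [M [g [sM gM gle gN]]] := clusters th q0 sz.
pose cl mu := [set b in B | g b == mu].
pose sp mu := [set a in A | [exists b in B, (g b == mu) && s a b]].
have scl mu : cl mu \subset B by apply/fintype.subsetP=> b; rewrite inE => /andP[].
have ssp mu : sp mu \subset A by apply/fintype.subsetP=> b; rewrite inE => /andP[].
have -> : edges r A B = (\sum_(mu in M) edges r (sp mu) (cl mu))%N.
  rewrite {1}/edges (partition_big g (mem M)) //=; apply: eq_bigr => mu muM.
  apply: eq_big => [b|b /andP[bB gb]]; first by rewrite inE.
  apply: eq_card => a; rewrite !inE; case: (a \in A) => //=.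
  case rab: (r a b); rewrite ?andbF ?andbT //; apply/esym/exists_inP; exists b => //.
  by rewrite gb rs.
pose L : F := 4 * ln #|A|.+1%:R * c.
have L0 : 0 <= L by rewrite !mulr_ge0 ?ln_nat_ge0.
rewrite natr_sum.
apply: (@le_trans _ _ (\sum_(mu in M) L * (k.-1%:R * #|sp mu|%:R + #|cl mu|%:R))).
  apply: ler_sum => mu muM; have muB := fintype.subsetP sM _ muM.
  have /andP[szq _] := sz _ muB.
  have /card_gt0P[a] : (0 < #|fib s A mu|)%N by apply: leq_trans szq.
  rewrite in_fib => /andP[aA samu].
  apply: (@edges_thin_common k r s A (sp mu) (cl mu) a) => //.
  - exact: thinS th.
  - move=> b; rewrite inE => /andP[bB /eqP gb]; have := fintype.subsetP (gle b bB) a.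
    by rewrite gb !in_fib aA samu => /(_ isT).
  - exact: biclique_boundS Hc.
rewrite -mulr_sumr -/L ler_wpM2l // big_split /= -mulr_sumr -!natr_sum.
have Ecl : (\sum_(mu in M) #|cl mu|)%N = #|B|.
  rewrite -[RHS]sum1_card [RHS](partition_big g (mem M)) //=; apply: eq_bigr => mu _.
  by rewrite -sum1_card; apply: eq_bigl => b; rewrite inE.
rewrite Ecl lerD2r -!natrX -!natrM ler_nat.
have Esp : (\sum_(mu in M) #|sp mu| <= #|A| * (k.-1 * (2 * k.-1)))%N.
  rewrite -[X in (X <= _)%N]/(edges (fun a mu => [exists b in B, (g b == mu) && s a b]) A M).
  by rewrite edges_rows -sum_nat_const; apply: leq_sum => a /gN.
apply: leq_trans (leq_mul (leqnn _) Esp) _.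
by rewrite leq_eqVlt; apply/orP; left; apply/eqP; ring.
Qed.

(** Absorbs the cubic cluster constant into the [k ^ 4] paid for each positive literal. *)
Lemma cube_bound (k : nat) : (0 < k)%N -> (4 * k.-1 ^ 3 <= k ^ 4)%N.
Proof.
case: k => // k _ /=.
case: (leqP k 3) => [|k3]; first by case: k => [|[|[|[|k]]]].
rewrite [X in (_ <= X)%N]expnS; apply: leq_mul; [lia|].
by rewrite leq_exp2r.
Qed.

(** The term in [#|A|] is paid on every dyadic level, which costs the second logarithm; the terms in
    [#|B|] add up over the levels. *)
Lemma edges_thin_biclique k r s A B c : (0 < k)%N -> 0 <= c -> thin k s A B ->
  (forall a b, r a b -> s a b) -> biclique_bound r s A B c ->
  (edges r A B)%:R <=
    8 * k%:R ^+ 4 * ln #|A|.+1%:R ^+ 2 * c * (#|A| + #|B|)%:R.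
Proof.
move=> k0 c0 th rs Hc.
have [A0|A0] := posnP #|A|.
  have -> : edges r A B = 0%N by have := edges_le r A B; rewrite A0; lia.
  by rewrite !mulr_ge0 ?exprn_ge0 ?ln_nat_ge0.
pose lv b := trunc_log 2 #|fib s A b|.
pose n := (trunc_log 2 #|A|).+1.
have lvn b : (lv b < n)%N by rewrite ltnS; apply: leq_trunc_log; apply: leq_fib.
(* As [trunc_log 2 0 = 0], empty fibres would land on level 0 and violate its lower size bound; they
   carry no edges. *)
pose B0 := [set b in B | (0 < #|fib s A b|)%N].
have sB0 : B0 \subset B by apply/fintype.subsetP=> b; rewrite inE => /andP[].
have -> : edges r A B = edges r A B0.
  rewrite (edgesIDr r A B B0) (finset.setIidPr sB0) [X in (_ + X)%N]edges0 ?addn0 //.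
  move=> a b aA; rewrite !inE negb_and => /andP[+ bB]; rewrite bB /= -eqn0Ngt cards_eq0 => /eqP f0.
  apply/negP => /rs sab; have : a \in fib s A b by rewrite in_fib aA.
  by rewrite f0 inE.
pose Bl i := [set b in B0 | lv b == i].
have -> : edges r A B0 = (\sum_(i < n) edges r A (Bl i))%N.
  by apply: sum_colors => b _.
have cB0 : (\sum_(i < n) #|Bl i| <= #|B|)%N.
  apply: leq_trans (subset_leq_card sB0); rewrite -[X in (_ <= X)%N]sum1_card.
  rewrite (@sum_colors _ B0 n lv (fun=> 1%N)) //; apply: leq_sum => i _.
  by rewrite sum1_card.
pose L : F := 4 * ln #|A|.+1%:R * c.
have L0 : 0 <= L by rewrite !mulr_ge0 ?ln_nat_ge0.
rewrite natr_sum.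
apply: (@le_trans _ _ (\sum_(i < n) L * (2 * k.-1%:R ^+ 3 * #|A|%:R + #|Bl i|%:R))).
  apply: ler_sum => i _.
  have sBl : Bl i \subset B.
    by apply: fintype.subset_trans sB0; apply/fintype.subsetP=> b; rewrite inE => /andP[].
  apply: (@edges_level k (2 ^ i) r s) => //.
  - exact: thinS th.
  - by rewrite expn_gt0.
  - move=> b; rewrite !inE -andbA => /and3P[_ b0 /eqP <-]; rewrite -expnS.
    by apply: trunc_log_bounds.
  - exact: biclique_boundS Hc.
rewrite -mulr_sumr big_split /= sumr_const card_ord -natr_sum -[_ *+ n]mulr_natl.
have {}cB0 : (\sum_(i < n) #|Bl i|)%:R <= #|B|%:R :> F by rewrite ler_nat.
have nl : n%:R <= 4 * ln #|A|.+1%:R :> F by apply: trunc_log_ln.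
have kb : 4 * k.-1%:R ^+ 3 <= k%:R ^+ 4 :> F.
  by rewrite -!natrX -natrM ler_nat cube_bound.
have l1 : 1 <= 2 * ln #|A|.+1%:R :> F by apply: ln_nat_half.
have k1 : 1 <= k%:R ^+ 4 :> F by rewrite -natrX ler1n expn_gt0 k0.
have a0 : 0 <= #|A|%:R :> F by rewrite ler0n.
have p0 : 0 <= k.-1%:R ^+ 3 :> F by rewrite exprn_ge0.
rewrite natrD /L; move: cB0 (ler0n F (\sum_(i < n) #|Bl i|)%N) nl kb l1 k1 a0 p0.
move: (_ ^+ 4) (_ ^+ 3) (ln _) (n%:R) (#|A|%:R) (#|B|%:R) (_%:R) => K P l N a b y.
move=> yb y0 Nl PK l1 K1 a0 P0.
have -> : 8 * K * l ^+ 2 * c * (a + b) = 4 * l * c * (2 * K * l * (a + b)) by ring.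
apply: ler_wpM2l; first by rewrite !mulr_ge0 //; lra.
have : N * (2 * P * a) <= 4 * l * (2 * P * a) by apply: ler_wpM2r => //; rewrite !mulr_ge0.
have : l * a * (4 * P) <= l * a * K by apply: ler_wpM2l => //; rewrite mulr_ge0 //; lra.
have : 1 * b <= (2 * l * K) * b.
  apply: ler_wpM2r; first lra.
  by have := ler_pM ler01 ler01 l1 K1; rewrite mulr1.
rewrite mul1r; lra.
Qed.

End Bicliques.

(** * Bounds for conjunctions of literals between finite sets *)

Section FiniteBounds.
Variables (F : realType) (I J : finType).
Implicit Types (r : I -> J -> bool) (A : {set I}) (B : {set J}) (k t d : nat).

Lemma edges_complete t A B : Ktt_free_in t (fun _ _ => true) A B ->
  (edges (fun _ _ => true) A B <= t.-1 * (#|A| + #|B|))%N.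
Proof.
move=> K; have := edges_le (fun _ _ : _ => true) A B.
have : (#|A| < t)%N || (#|B| < t)%N by apply: K.
by case: t {K} => // t; rewrite !ltnS /= => /orP[]; nia.
Qed.

(** [r0] is the core with a known linear bound: a single semi-equation, or the conjunction of all
    negative literals. Each positive literal joined to it costs one application of
    [edges_thin_biclique]. *)
Lemma edges_pos k t d r0 r (s : 'I_d -> I -> J -> bool) A B (C : F) :
  (0 < k)%N -> 0 <= C ->
  (forall A' B', A' \subset A -> B' \subset B -> Ktt_free_in t r0 A' B' ->
     (edges r0 A' B')%:R <= C * (#|A'| + #|B'|)%:R) ->
  (forall a b, r a b = r0 a b && [forall i, s i a b]) ->
  (forall i, thin k (s i) A B) -> Ktt_free_in t r A B ->
  (edges r A B)%:R <=
    (8 * k%:R ^+ 4 * ln #|A|.+1%:R ^+ 2) ^+ d * C * (#|A| + #|B|)%:R.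
Proof.
move=> k0 C0; elim: d r s A B => [|d IHd] r s A B H0 rE th K.
  rewrite expr0 mul1r (eq_edges (r' := r0)); last first.
    by move=> a b _ _; rewrite rE; case: (r0 a b) => //=; apply/forallP=> -[].
  apply: H0 => //; apply: Ktt_free_inS K => // a b _ _ rab.
  by rewrite rE rab; apply/forallP=> -[].
pose r' a b := r0 a b && [forall i, s (lift ord0 i) a b].
have rE' a b : r a b = r' a b && s ord0 a b.
  rewrite rE /r' -andbA; congr (_ && _); apply/forallP/andP.
    by move=> h; split=> //; apply/forallP.
  move=> [/forallP h h0] i.
  by have [j ->|->] := unliftP ord0 i.
have X0 A' : 0 <= 8 * k%:R ^+ 4 * ln #|A'|.+1%:R ^+ 2 :> F.
  by rewrite !mulr_ge0 // ?exprn_ge0 ?ln_nat_ge0.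
rewrite exprS -[_ * _ * C]mulrA.
apply: (edges_thin_biclique k0 _ (th ord0)).
- by rewrite mulr_ge0 ?exprn_ge0.
- by move=> a b; rewrite rE' => /andP[].
move=> A' B' sA sB cs.
rewrite (eq_edges (r' := r')); last first.
  by move=> a b aA bB; rewrite rE' cs ?andbT.
apply: le_trans (IHd r' (fun i => s (lift ord0 i)) A' B' _ _ _ _) _ => //.
- move=> A1 B1 sA1 sB1; apply: H0; first exact: fintype.subset_trans sA1 sA.
  exact: fintype.subset_trans sB1 sB.
- by move=> i; apply: thinS (th _).
- apply: Ktt_free_inS K => // a b aA bB; rewrite rE' => ->.
  exact: cs.
rewrite ler_wpM2r // ler_wpM2r // lerXn2r ?nnegrE //.
rewrite ler_wpM2l ?mulr_ge0 ?exprn_ge0 // lerXn2r ?nnegrE ?ln_nat_ge0 //.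
by rewrite ler_ln_nat // subset_leq_card.
Qed.

(** The heavy chain stays a chain after complementation, so on it the literal [~~ s j] is removed at
    the cost of one logarithm; the proportions [1 / (t d k)] lost at the successive steps produce
    the factorial and the powers of [t] and [k]. *)
Lemma edges_neg k t d r (s : 'I_d.+1 -> I -> J -> bool) A B :
  (0 < k)%N -> (0 < t)%N ->
  (forall a b, r a b = [forall i, ~~ s i a b]) ->
  (forall i, thin k (s i) A B) -> Ktt_free_in t r A B ->
  (edges r A B)%:R <=
    8 ^+ d * k%:R ^+ d.+1 * d.+1`!%:R * t%:R ^+ d.+2 * ln #|A|.+1%:R ^+ d
      * (#|A| + #|B|)%:R :> F.
Proof.
move=> k0 t0; elim: d r s A B => [|d IHd] r s A B rE th K.
  rewrite !expr0 mul1r mulr1 expr1 -natrX -!natrM ler_nat muln1.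
  (* Below the threshold of [heavy_chain] the trivial bound by the product of the sizes is good
     enough. *)
  have [Akt|ktA] := ltnP #|A| (k * t).
    apply: leq_trans (edges_le _ _ _) _.
    apply: (@leq_trans (k * t * #|B|)); first by rewrite leq_mul2r (ltnW Akt) orbT.
    apply: leq_mul; last exact: leq_addl.
    by rewrite leq_mul2l -mulnn leq_pmull ?orbT.
  have [j [B' [sB' nB' le]]] := heavy_chain rE th t0 k0 K ktA.
  have : (edges r A B' <= t.-1 * (#|A| + #|B'|))%N.
    have nB'' := nested_compl nB'.
    have E : edges r A B' = edges (fun a b => ~~ s j a b) A B'.
      apply: eq_edges => a b _ _; rewrite rE; apply/forallP/idP; first exact.
      by move=> h i; rewrite (_ : i = j) // !ord1.
    rewrite E; apply: edges_nested => //.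
    apply: Ktt_free_inS K => // a b _ _ h; rewrite rE; apply/forallP=> i.
    by rewrite (_ : i = j) // !ord1.
  have := subset_leq_card sB'; move: le; rewrite muln1 -mulnn.
  move: (edges r A B) (edges r A B') #|A| #|B| #|B'| => e e' m n n'.
  clear -t0 k0; case: t t0 => // t _ /= he hn he'.
  apply: (leq_trans he).
  have : (e' <= t * (m + n))%N by apply: leq_trans he' _; rewrite leq_mul2l leq_add2l hn orbT.
  move=> {}he'; have := leq_mul (leqnn (t.+1 * k)) he'.
  have : (t * m <= t.+1 * k * (m + n))%N by apply: leq_mul; rewrite ?leq_addr //; nia.
  nia.
have [A0|A0] := posnP #|A|.
  have -> : edges r A B = 0%N by have := edges_le r A B; rewrite A0; lia.
  by rewrite !(exprn_ge0, mulr_ge0, ler0n, ln_nat_ge0).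
set l : F := ln #|A|.+1%:R.
have l1 : 1 <= 2 * l by apply: ln_nat_half.
have l0 : 0 <= l := ln_nat_ge0 F #|A|.
have k1 : 1 <= k%:R :> F by rewrite ler1n.
have t1 : 1 <= t%:R :> F by rewrite ler1n.
pose c : F := 8 ^+ d * k%:R ^+ d.+1 * d.+1`!%:R * t%:R ^+ d.+2 * l ^+ d.
have c1 : 1 <= c.
  have -> : c = (8 * l) ^+ d * k%:R ^+ d.+1 * d.+1`!%:R * t%:R ^+ d.+2.
    by rewrite /c exprMn; ring.
  have h8 : 1 <= 8 * l by lra.
  by rewrite !(h8, exprn_ege1, ler1n, fact_gt0, mulr_ege1).
have c0 : 0 <= c by apply: le_trans c1.
have E : 8 ^+ d.+1 * k%:R ^+ d.+2 * d.+2`!%:R * t%:R ^+ d.+3 * l ^+ d.+1 =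
    8 * k%:R * d.+2%:R * t%:R * l * c.
  by rewrite /c [d.+2`!]factS natrM (exprS 8) (exprS _ d.+1) (exprS _ d.+2) (exprS l); ring.
rewrite E.
have [Akt|ktA] := ltnP #|A| (k * t).
  apply: (@le_trans _ _ (k%:R * t%:R * (#|A| + #|B|)%:R)).
    rewrite -!natrM ler_nat; apply: leq_trans (edges_le _ _ _) _.
    apply: (@leq_trans (k * t * #|B|)); first by rewrite leq_mul2r (ltnW Akt) orbT.
    by apply: leq_mul => //; apply: leq_addl.
  apply: ler_wpM2r => //.
  have -> : 8 * k%:R * d.+2%:R * t%:R * l * c = (8 * d.+2%:R * l * c) * (k%:R * t%:R) by ring.
  rewrite -[X in X <= _]mul1r; apply: ler_wpM2r; first by rewrite mulr_ge0.
  have h8 : 1 <= 8 * l by lra.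
  by rewrite mulr_ege1 // mulrAC mulr_ege1 // ler1n.
have [j [B' [sB' nB' le]]] := heavy_chain rE th t0 k0 K ktA.
pose r' a b := [forall i, ~~ s (lift j i) a b].
have rE' a b : r a b = ~~ s j a b && r' a b.
  rewrite rE; apply/forallP/andP.
    by move=> h; split=> //; apply/forallP.
  move=> [h0 /forallP h] i.
  by have [i' ->|->] := unliftP j i.
have H : (edges r A B')%:R <= 4 * l * c * (#|A| + #|B'|)%:R.
  apply: edges_nested_biclique (nested_compl nB') _ _ => //.
    by move=> a b; rewrite rE' => /andP[].
  move=> A1 B1 sA1 sB1 cs.
  have sB1B := fintype.subset_trans sB1 sB'.
  rewrite (eq_edges (r' := r')); last by move=> a b aA bB; rewrite rE' cs.
  apply: le_trans (IHd r' (fun i => s (lift j i)) A1 B1 _ _ _) _ => //.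
  - by move=> i; apply: thinS (th _).
  - apply: Ktt_free_inS K => // a b aA bB; rewrite rE' => ->.
    by rewrite andbT; apply: cs.
  rewrite ler_wpM2r // /c ler_wpM2l ?(exprn_ge0, mulr_ge0) //.
  by rewrite lerXn2r ?nnegrE ?ln_nat_ge0 // ler_ln_nat // subset_leq_card.
have hB : (#|A| + #|B'|)%:R <= (#|A| + #|B|)%:R :> F.
  by rewrite ler_nat leq_add2l subset_leq_card.
have hA : #|A|%:R <= (#|A| + #|B|)%:R :> F by rewrite ler_nat leq_addr.
move: le; rewrite -(ler_nat F) natrD !natrM => le; apply: le_trans le _.
have d1 : 1 <= d.+2%:R :> F by rewrite ler1n.
have tt : t.-1%:R <= t%:R :> F by rewrite ler_nat leq_pred.
set S := (#|A| + #|B|)%:R.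
have S0 : 0 <= S :> F by rewrite ler0n.
apply: (@le_trans _ _ (t%:R * S + t%:R * d.+2%:R * k%:R * (4 * l * c * S))).
  apply: lerD; first by rewrite ler_pM.
  apply: ler_wpM2l; first by rewrite !mulr_ge0.
  apply: (le_trans H); apply: ler_wpM2l => //.
  by apply: mulr_ge0 => //; apply: mulr_ge0.
(* Half of the factor 8 pays for the heavy chain. The other half covers the edges at bad values, as
   its coefficient of [t%:R * S] is at least 1. *)
have -> : 8 * k%:R * d.+2%:R * t%:R * l * c * S =
  (4 * l * c * (k%:R * d.+2%:R)) * (t%:R * S) + t%:R * d.+2%:R * k%:R * (4 * l * c * S) by ring.
rewrite lerD2r -[X in X <= _]mul1r; apply: ler_wpM2r; first by rewrite mulr_ge0.
have l4 : 1 <= 4 * l by lra.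
apply: mulr_ege1; apply: mulr_ege1 => //.
Qed.

End FiniteBounds.

(** * Zarankiewicz bounds *)

Local Open Scope classical_set_scope.
Local Open Scope card_scope.

(** Replaces finite subsets of arbitrary types by the index types ['I_n], to which the finite bounds
    apply. *)
Lemma card_eq_ordP (T : Type) (A : set T) (n : nat) :
  A #= `I_n <-> exists2 f : 'I_n -> T, injective f & A = range f.
Proof.
split.
  elim: n A => [|n IHn] A.
    rewrite II0 card_eq0 => /eqP->.
    exists (fun i : 'I_0 => False_rect T (notF (ltn_ord i))); first by case.
    by apply/seteqP; split=> // x [[]].
  move=> /eq_cardSP[x Ax /IHn[f finj fE]].
  have fA i : (A `\ x) (f i) by rewrite fE; exists i.
  exists (fun i => oapp f x (unlift ord0 i)).
    move=> i j; have [i' ->|->] := unliftP ord0 i; have [j' ->|->] := unliftP ord0 j;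
      rewrite ?liftK ?unlift_none //= => E.
    - by rewrite (finj _ _ E).
    - by have [_ []] := fA i'.
    - by have [_ []] := fA j'.
  apply/seteqP; split=> [y Ay|_ [i _ <-]].
    have [->|yx] := pselect (y = x).
      by exists ord0 => //; rewrite unlift_none.
    have : (A `\ x) y by [].
    by rewrite fE => -[i _ <-]; exists (lift ord0 i) => //; rewrite liftK.
  by case: (unlift _ i) => //= j; have [] := fA j.
move=> [f finj ->].
have E : [set: 'I_n] #= `I_n.
  have -> : `I_n = range (val : 'I_n -> nat).
    by apply/seteqP; split=> [i /= im|_ [i _ <-]]; [exists (Ordinal im)|exact: ltn_ord].
  by rewrite card_eq_sym; apply: inj_card_eq => i j _ _ /val_inj.
by apply: card_eq_trans E; apply: inj_card_eq => i j _ _ /finj.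
Qed.

Lemma card_eq_image_finset (T : Type) (J : finType) (h : J -> T) (Q : {set J}) :
  injective h -> h @` [set` Q] #= `I_#|Q|.
Proof.
move=> hi; apply/card_eq_ordP; exists (fun i => h (enum_val i)).
  by move=> i j /hi /enum_val_inj.
apply/seteqP; split=> [_ [x xQ <-]|_ [i _ <-]].
  by exists (enum_rank_in xQ x) => //; rewrite enum_rankK_in.
by exists (enum_val i) => //; apply: enum_valP.
Qed.

Section Transfer.
Variables (X Y : Type).
Implicit Types (R : set (X * Y)).

Definition pulled m n (f : 'I_m -> X) (g : 'I_n -> Y) R (a : 'I_m) (b : 'I_n) : bool :=
  `[< R (f a, g b) >].

Lemma semi_equation_thin k R m n (f : 'I_m -> X) (g : 'I_n -> Y) :
  semi_equation k R -> thin k (pulled f g R) [set: 'I_m]%SET [set: 'I_n]%SET.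
Proof.
move=> sR a Q _ _ aQ antQ; rewrite ltnNge; apply/negP => /card_geqP[q [uq sq qQ]].
(* For [k = 0] the empty intersection contains [f a], and the semi-equation would produce an element
   of ['I_0]. *)
case: k sR sq => [|k] sR sq.
  have [|i _] := sR (fun i : 'I_0 => False_rect Y (notF (ltn_ord i))).
  - by exists (f a) => -[].
  - by case: i.
have [b0 _] : exists b0, b0 \in q by case: q {uq qQ} sq => // b q _; exists b; rewrite inE eqxx.
have qi (i : 'I_k.+1) : nth b0 q i \in Q by apply/qQ/mem_nth; rewrite sq.
have [|i [j [ij sij]]] := sR (fun i => g (nth b0 q i)).
  by exists (f a) => i _; rewrite /ysection /= inE; apply/asboolP/(aQ _ (qi i)).
move/eqP: ij; apply; apply/val_inj/eqP; rewrite -(nth_uniq b0 _ _ uq) ?sq ?ltn_ord //.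
apply/eqP; apply: (antQ _ _ (qi i) (qi j)); apply/fintype.subsetP=> x.
rewrite !in_fib => /andP[_ xi].
rewrite finset.in_setT /=; have := sij (f x); rewrite /ysection /= !inE => h.
by move/asboolP: xi => /h.
Qed.

Lemma Ktt_free_transfer t m n (f : 'I_m -> X) (g : 'I_n -> Y) R :
  injective f -> injective g ->
  Ktt_free t (R `&` (range f `*` range g)) ->
  Ktt_free_in t (pulled f g R) [set: 'I_m]%SET [set: 'I_n]%SET.
Proof.
move=> fi gi K A B _ _ c; apply/negPn/negP; rewrite negb_or -!leqNgt => /andP[tA tB].
have /sub_card[A1 sA1 A1t] := tA; have /sub_card[B1 sB1 B1t] := tB.
apply: K; exists (f @` [set` A1]), (g @` [set` B1]); split.
- by rewrite -A1t; apply: card_eq_image_finset.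
- by rewrite -B1t; apply: card_eq_image_finset.
move=> [x y] [] /= [a aA1 <-] [b bB1 <-]; split; last by split; [exists a|exists b].
by apply/asboolP; apply: c; [apply: (fintype.subsetP sA1)|apply: (fintype.subsetP sB1)].
Qed.

Lemma card_edges_pulled m n (f : 'I_m -> X) (g : 'I_n -> Y) R :
  injective f -> injective g ->
  R `&` (range f `*` range g) #=
    `I_(edges (pulled f g R) [set: 'I_m]%SET [set: 'I_n]%SET).
Proof.
move=> fi gi; rewrite edges_pairs.
pose Q := [set p in finset.setX [set: 'I_m] [set: 'I_n] | pulled f g R p.1 p.2]%SET.
have hi : injective (fun p : 'I_m * 'I_n => (f p.1, g p.2)).
  by move=> [a b] [c d] /= [/fi-> /gi->].
have := card_eq_image_finset Q hi; rewrite (_ : _ @` _ = R `&` (range f `*` range g)) //.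
apply/seteqP; split=> [_ [[a b] abQ <-]|[x y] [Rxy [] /= [a _ ax] [b _ bY]]].
  split; last by split; [exists a|exists b].
  by move: abQ; rewrite /= inE => /andP[_ /asboolP].
exists (a, b); last by rewrite /= ax bY.
rewrite /= inE finset.in_setX !finset.in_setT /=; apply/asboolP.
by rewrite ax bY.
Qed.

(** Nonnegativity of [c] covers the maximum over no value, which is 0. *)
Lemma zarankiewicz_le (F : realType) t m n R (c : F) : 0 <= c ->
  (forall (f : 'I_m -> X) (g : 'I_n -> Y), injective f -> injective g ->
    Ktt_free t (R `&` (range f `*` range g)) ->
    (edges (pulled f g R) [set: 'I_m]%SET [set: 'I_n]%SET)%:R <= c) ->
  (zarankiewicz t m n R)%:R <= c.
Proof.
move=> c0 h; rewrite /zarankiewicz.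
elim/big_ind: _ => // [x y xc yc|e /asboolP[A [B [Am Bn K eE]]]].
  by rewrite /maxn; case: ifP.
have /card_eq_ordP[f fi fE] := Am; have /card_eq_ordP[g gi gE] := Bn.
rewrite fE gE in K eE.
have /card_eq_II -> := card_eq_trans (card_esym eE) (card_edges_pulled R fi gi).
exact: h.
Qed.

Lemma edges_le_zarankiewicz t m n R (f : 'I_m -> X) (g : 'I_n -> Y) :
  injective f -> injective g -> Ktt_free t (R `&` (range f `*` range g)) ->
  (edges (pulled f g R) [set: 'I_m]%SET [set: 'I_n]%SET <= zarankiewicz t m n R)%N.
Proof.
move=> fi gi K; set e := edges _ _ _.
have le : (e < (m * n).+1)%N.
  by rewrite ltnS; apply: leq_trans (edges_le _ _ _) _; rewrite !cardsT !card_ord.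
apply: (leq_bigmax_cond (F := fun i : 'I_(m * n).+1 => i : nat) (Ordinal le)); apply/asboolP.
exists (range f), (range g); split=> //.
- by apply/card_eq_ordP; exists f.
- by apply/card_eq_ordP; exists g.
exact: card_edges_pulled.
Qed.

Lemma zarankiewicz_bound (F : realType) (k d d' : nat)
    (Rp : 'I_d -> set (X * Y)) (Rn : 'I_d' -> set (X * Y)) (t m n : nat) :
  (0 < k)%N -> (forall i, semi_equation k (Rp i)) ->
  (forall j, semi_equation k (Rn j)) -> (0 < t)%N -> (0 < m)%N ->
  (zarankiewicz t m n ((\bigcap_i Rp i) `&` (\bigcap_j ~` Rn j)))%:R <=
  (if (0 < d')%N then
     8 ^+ (d + d' - 1) * k%:R ^+ (4 * d + d') * d'`!%:R
       * t%:R ^+ d'.+1 * (m + n)%:R * ln m.+1%:R ^+ (2 * d + d' - 1)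
   else if (0 < d)%N then
     8 ^+ (d - 1) * k%:R ^+ (4 * d - 3) * (t%:R - 1) ^+ 2
       * (m + n)%:R * ln m.+1%:R ^+ (2 * d - 2)
   else (t%:R - 1) * (m + n)%:R :> F).
Proof.
move=> k0 sp sn t0 m0; set R := _ `&` _.
have t1 : 0 <= t%:R - 1 :> F by rewrite subr_ge0 ler1n.
apply: zarankiewicz_le.
  case: ifP => _; last case: ifP => _; rewrite ?mulr_ge0 //;
  by rewrite !(exprn_ge0, mulr_ge0, ler0n, ln_nat_ge0).
move=> f g fi gi /(Ktt_free_transfer fi gi) K.
set A := [set: 'I_m]%SET; set B := [set: 'I_n]%SET.
have cA : #|A| = m by rewrite cardsT card_ord.
have cB : #|B| = n by rewrite cardsT card_ord.
have thp i : thin k (pulled f g (Rp i)) A B by apply: semi_equation_thin.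
have thn i : thin k (pulled f g (Rn i)) A B by apply: semi_equation_thin.
pose r0 a b := [forall j, ~~ pulled f g (Rn j) a b].
have rE a b : pulled f g R a b = r0 a b && [forall i, pulled f g (Rp i) a b].
  apply/asboolP/andP.
    move=> [hp hn]; split; apply/forallP=> i; first by apply/asboolPn; apply: hn.
    by apply/asboolP; apply: hp.
  move=> [/forallP hn /forallP hp]; split=> i _.
    by apply/asboolP; apply: hp.
  by move: (hn i) => /asboolPn.
have l0 : 0 <= ln m.+1%:R :> F := ln_nat_ge0 F m.
have tE : t.-1%:R = t%:R - 1 :> F by rewrite -subn1 natrB.
case: d' => [|d'] in Rn R sn K thn r0 rE *.
  case: d => [|d] in Rp R sp K thp r0 rE *.
    have E : forall a b, pulled f g R a b = true.
      by move=> a b; rewrite rE; apply/andP; split; apply/forallP=> -[].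
    rewrite (eq_edges (r' := fun _ _ => true)) //= -tE -natrM ler_nat -{3}cA -{3}cB.
    apply: edges_complete; apply: Ktt_free_inS K => // a b _ _ _; exact: E.
  (* Without negative literals one positive literal serves as the core and is bounded directly, free
     of logarithms; only the others pay for removal. *)
  pose r1 := pulled f g (Rp ord0).
  have rE' a b : pulled f g R a b = r1 a b && [forall i, pulled f g (Rp (lift ord0 i)) a b].
    rewrite rE; apply/andP/andP=> [[_ /forallP h]|[h0 /forallP h]].
      by split; [apply: h|apply/forallP].
    split; apply/forallP; first by case.
    by move=> i; have [j ->|->] := unliftP ord0 i.
  have := @edges_pos F _ _ k t d r1 (pulled f g R)
    (fun i => pulled f g (Rp (lift ord0 i))) A B (k%:R * (t%:R - 1) ^+ 2) k0 _ _ rE' _ K.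
  rewrite cA cB => /(_ _ _ (fun i => thp _)) H.
  apply: le_trans (H _ _) _.
  - by rewrite mulr_ge0 // exprn_ge0.
  (* The coefficients [(k - 1) (t - 1)] and [t - 1] are both weakened to [k (t - 1) ^ 2]; for
     [t = 1] all of these vanish. *)
  - move=> A' B' sA sB K'; rewrite -tE -natrX -!natrM ler_nat.
    apply: leq_trans (edges_thin (thinS sA sB (thp ord0)) K') _.
    rewrite mulnDr; apply: leq_add; rewrite leq_mul2r; apply/orP; right.
      by case: (k) (t.-1) => // k' [|t']; rewrite -mulnn; nia.
    by case: (k) k0 (t.-1) => // k' _ [|t']; rewrite -mulnn; nia.
  rewrite /= subn1 /= (_ : (4 * d.+1 - 3 = (4 * d).+1)%N); last lia.
  rewrite (_ : (2 * d.+1 - 2 = 2 * d)%N); last lia.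
  rewrite exprMn [(8 * _) ^+ d]exprMn -!exprM [k%:R ^+ _.+1]exprS.
  rewrite le_eqVlt; apply/orP; left; apply/eqP.
  move: (8 ^+ d) (k%:R ^+ _) (_ ^+ (2 * d)) => ? ? ?; ring.
(* With negative literals present, their conjunction is the core and all [d] positive literals are
   joined to it. *)
pose C : F := 8 ^+ d' * k%:R ^+ d'.+1 * d'.+1`!%:R * t%:R ^+ d'.+2 * ln m.+1%:R ^+ d'.
have C0 : 0 <= C by rewrite !(exprn_ge0, mulr_ge0, ler0n).
have := @edges_pos F _ _ k t d r0 (pulled f g R)
    (fun i => pulled f g (Rp i)) A B C k0 C0 _ rE thp K.
rewrite cA cB => H; apply: le_trans (H _) _.
  move=> A' B' sA sB K'.
  apply: le_trans (edges_neg F k0 t0 (fun _ _ => erefl) (fun i => thinS sA sB (thn i)) K') _.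
  rewrite ler_wpM2r // ler_wpM2l ?(exprn_ge0, mulr_ge0, ler0n) //.
  rewrite lerXn2r ?nnegrE ?ln_nat_ge0 // ler_ln_nat //.
  by apply: leq_trans (subset_leq_card sA) _; rewrite cA.
rewrite /= (_ : (d + d'.+1 - 1 = d + d')%N); last lia.
rewrite (_ : (2 * d + d'.+1 - 1 = 2 * d + d')%N); last lia.
rewrite /C exprMn [(8 * _) ^+ d]exprMn -!exprM !exprD le_eqVlt; apply/orP; left; apply/eqP; ring.
Qed.

End Transfer.

(** For [p > 0] and [dl = eps / p], the inequality [ln x <= x - 1] at [x = (2 n) ^ dl] bounds
    [dl * ln (2 n)] by [(2 n) ^ dl]; the [p]-th power gives the claim. *)
Lemma ln_expr_powR (F : realType) (p : nat) (eps : F) : 0 < eps ->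
  exists2 C, 0 <= C & forall n, (0 < n)%N -> ln n.+1%:R ^+ p <= C * n%:R `^ eps.
Proof.
move=> e0; case: p => [|p].
  exists 1 => // n n0; rewrite expr0 mul1r -[X in X <= _](powRr0 n%:R).
  by apply: ler_powR; rewrite ?ler1n // ltW.
pose dl := eps / p.+1%:R.
have d0 : 0 < dl by rewrite divr_gt0.
exists ((2 `^ dl / dl) ^+ p.+1); first by rewrite exprn_ge0 // divr_ge0 ?powR_ge0 // ltW.
move=> n n0.
have n0' : 0 < n%:R :> F by rewrite ltr0n.
have -> : n%:R `^ eps = (n%:R `^ dl) ^+ p.+1.
  by rewrite -powR_mulrn ?powR_ge0 // -powRrM /dl divfK // pnatr_eq0.
rewrite -exprMn lerXn2r ?nnegrE ?ln_nat_ge0 //.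
  by rewrite mulr_ge0 ?divr_ge0 ?powR_ge0 // ltW.
rewrite mulrAC -powRM ?ler0n // ler_pdivlMr // mulrC.
have h : n.+1%:R <= 2 * n%:R :> F by rewrite -natrM ler_nat; lia.
have p0 : 0 < (2 * n%:R) `^ dl :> F by apply: powR_gt0; apply: mulr_gt0.
apply: (@le_trans _ _ (ln ((2 * n%:R) `^ dl))).
  by rewrite ln_powR (ler_wpM2l (ltW d0)) // ler_ln ?posrE ?mulr_gt0 ?ltr0n.
have := @le_ln1Dx F ((2 * n%:R) `^ dl - 1).
rewrite [1 + _]addrC subrK => /(_ _) H; apply: le_trans (H _) _; lra.
Qed.

(** * Almost linear bounds for Boolean combinations *)

Section AlmostLinear.
Variables (F : realType) (X Y : Type) (k : nat).
Hypothesis k0 : (0 < k)%N.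
Implicit Types (R S Q : set (X * Y)).

Definition literal_conj R : Prop :=
  exists (d d' : nat) (Rp : 'I_d -> set (X * Y)) (Rn : 'I_d' -> set (X * Y)),
    [/\ forall i, semi_equation k (Rp i), forall j, semi_equation k (Rn j)
      & R = (\bigcap_i Rp i) `&` (\bigcap_j ~` Rn j)].

Lemma bigcap_unlift (T : Type) (A : set T) n (E : 'I_n -> set T) :
  \bigcap_i (oapp E A (unlift ord0 i)) = A `&` \bigcap_i E i.
Proof.
apply/seteqP; split=> [x h|x [hA hE] i _].
  split=> [|i _]; first by have := h ord0 I; rewrite unlift_none.
  by have := h (lift ord0 i) I; rewrite liftK.
by case: (unliftP ord0 i) => [j _|_] /=; [apply: hE|].
Qed.

Lemma literal_conjT : literal_conj setT.
Proof.
exists 0%N, 0%N, (fun=> setT), (fun=> setT); split; try by case.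
by apply/seteqP; split=> // x _; split=> -[].
Qed.

Lemma literal_conjP R Q : semi_equation k R -> literal_conj Q -> literal_conj (R `&` Q).
Proof.
move=> sR [d [d' [Rp [Rn [sp sn ->]]]]].
exists d.+1, d', (fun i => oapp Rp R (unlift ord0 i)), Rn; split=> //.
  by move=> i; case: (unlift _ _).
by rewrite bigcap_unlift setIA.
Qed.

Lemma literal_conjN R Q : semi_equation k R -> literal_conj Q -> literal_conj (~` R `&` Q).
Proof.
move=> sR [d [d' [Rp [Rn [sp sn ->]]]]].
exists d, d'.+1, Rp, (fun i => oapp Rn R (unlift ord0 i)); split=> //.
  by move=> i; case: (unlift _ _).
have -> : \bigcap_i ~` oapp Rn R (unlift ord0 i) =
    \bigcap_i oapp (fun j => ~` Rn j) (~` R) (unlift ord0 i).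
  by apply: eq_bigcapr => i _; case: (unlift _ _).
by rewrite bigcap_unlift setICA.
Qed.

Lemma literal_conj_almost_linear R : literal_conj R -> almost_linear_zarankiewicz F R.
Proof.
move=> [d [d' [Rp [Rn [sp sn ->]]]]] t eps t0 e0.
suff [c [p [c0 h]]] : exists c p, 0 <= c /\ forall n, (0 < n)%N ->
    (zarankiewicz t n n ((\bigcap_i Rp i) `&` (\bigcap_j ~` Rn j)))%:R <=
      c * n%:R * ln n.+1%:R ^+ p :> F.
  have [C C0 hC] := ln_expr_powR p e0.
  exists (c * C) => n n0; apply: le_trans (h n n0) _.
  have n0' : n%:R != 0 :> F by rewrite pnatr_eq0 -lt0n.
  rewrite powRD; last by rewrite n0' implybT.
  rewrite powRr1 // -!mulrA ler_wpM2l // [C * _]mulrCA ler_wpM2l //.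
  exact: hC.
have t1 : 0 <= t%:R - 1 :> F by rewrite subr_ge0 ler1n.
have H n (n0 : (0 < n)%N) := @zarankiewicz_bound X Y F k d d' Rp Rn t n n k0 sp sn t0 n0.
case: (0 < d')%N H => H; last case: (0 < d)%N H => H.
- exists (8 ^+ (d + d' - 1) * k%:R ^+ (4 * d + d') * d'`!%:R * t%:R ^+ d'.+1 * 2),
    (2 * d + d' - 1)%N.
  split=> [|n n0]; first by rewrite !(exprn_ge0, mulr_ge0, ler0n).
  by apply: le_trans (H n n0) _; rewrite addnn -mul2n natrM !mulrA.
- exists (8 ^+ (d - 1) * k%:R ^+ (4 * d - 3) * (t%:R - 1) ^+ 2 * 2), (2 * d - 2)%N.
  split=> [|n n0]; first by rewrite !(exprn_ge0, mulr_ge0, ler0n).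
  by apply: le_trans (H n n0) _; rewrite addnn -mul2n natrM !mulrA.
- exists ((t%:R - 1) * 2), 0%N; split=> [|n n0]; first by rewrite mulr_ge0.
  by apply: le_trans (H n n0) _; rewrite addnn -mul2n natrM !mulrA expr0 mulr1.
Qed.

Lemma Ktt_freeS (t : nat) R S : R `<=` S -> Ktt_free t S -> Ktt_free t R.
Proof.
move=> sRS K [A [B [At Bt sAB]]]; apply: K; exists A, B; split=> //.
exact: subset_trans sRS.
Qed.

(** Where the union is [K_{t,t}]-free both members are, and the edges of the union are at most the
    sum of theirs. *)
Lemma almost_linearU R S : almost_linear_zarankiewicz F R ->
  almost_linear_zarankiewicz F S -> almost_linear_zarankiewicz F (R `|` S).
Proof.
move=> aR aS t eps t0 e0; have [C hC] := aR t eps t0 e0; have [D hD] := aS t eps t0 e0.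
exists (C + D) => n n0.
apply: (@le_trans _ _ (zarankiewicz t n n R + zarankiewicz t n n S)%:R); last first.
  by rewrite natrD mulrDl lerD ?hC ?hD.
apply: zarankiewicz_le => // f g fi gi K; rewrite ler_nat.
have sR : R `&` (range f `*` range g) `<=` (R `|` S) `&` (range f `*` range g).
  by move=> x [Rx]; split=> //; left.
have sS : S `&` (range f `*` range g) `<=` (R `|` S) `&` (range f `*` range g).
  by move=> x [Sx]; split=> //; right.
apply: leq_trans (leq_add (edges_le_zarankiewicz fi gi (Ktt_freeS sR K))
  (edges_le_zarankiewicz fi gi (Ktt_freeS sS K))).
rewrite -big_split; apply: leq_sum => b _.
apply: leq_trans (leq_card_setU _ _).1; apply/subset_leq_card/fintype.subsetP=> a.
rewrite finset.in_setU !in_fib !finset.in_setT /= => /asboolP[h|h].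
  by apply/orP; left; apply/asboolP.
by apply/orP; right; apply/asboolP.
Qed.

Lemma almost_linear0 : almost_linear_zarankiewicz F (set0 : set (X * Y)).
Proof.
move=> t eps t0 e0; exists 0 => n n0; rewrite mul0r.
apply: zarankiewicz_le => // f g fi gi _; rewrite edges0 // => a b _ _.
by apply/asboolP.
Qed.

(* Conjunctions of literals are tested against [S]: this makes the class of [R]
   preserving the property closed under all Boolean operations. *)
Definition conj_almost_linear S : Prop :=
  forall Q, literal_conj Q -> almost_linear_zarankiewicz F (S `&` Q).

Lemma conj_almost_linearU R S : conj_almost_linear R -> conj_almost_linear S ->
  conj_almost_linear (R `|` S).
Proof. by move=> aR aS Q lQ; rewrite setIUl; apply: almost_linearU; [apply: aR|apply: aS]. Qed.

(** A generator or its complement is absorbed into the conjunction [Q], intersections are iterated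
    tests, and unions are covered by [almost_linearU]. De Morgan's laws exchange the last two, so
    [R] and its complement are carried together. *)
Lemma bool_comb_conj_almost_linear R :
  bool_comb_set [set Q | semi_equation k Q] R ->
  forall S, conj_almost_linear S ->
    conj_almost_linear (R `&` S) /\ conj_almost_linear (~` R `&` S).
Proof.
elim=> {R} [A sA||A _ IA|A B _ IA _ IB|A B _ IA _ IB] S aS.
- split=> Q lQ; rewrite setIAC setIC; apply: aS.
    exact: literal_conjP.
  exact: literal_conjN.
- rewrite setTI setCT set0I; split=> // Q lQ; rewrite set0I; exact: almost_linear0.
- by rewrite setCK; have [] := IA S aS.
- have [aAS anAS] := IA _ aS; have [aBS anBS] := IB _ aS.
  have [aABS _] := IA _ aBS; have [aAnBS _] := IA _ anBS.
  rewrite -setIA; split=> //; rewrite setCI setIUl.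
  exact: conj_almost_linearU.
- have [aAS anAS] := IA _ aS; have [aBS anBS] := IB _ aS.
  have [_ anAnBS] := IA _ anBS.
  by rewrite setIUl setCU -setIA; split=> //; apply: conj_almost_linearU.
Qed.

Lemma bool_comb_almost_linear R :
  bool_comb_set [set Q | semi_equation k Q] R -> almost_linear_zarankiewicz F R.
Proof.
move=> bR; have aT : conj_almost_linear setT.
  by move=> Q lQ; rewrite setTI; apply: literal_conj_almost_linear.
have [+ _] := bool_comb_conj_almost_linear bR aT.
by move=> /(_ _ literal_conjT); rewrite !setIT.
Qed.

End AlmostLinear.

(** * Interpreted fields *)

Section Renaming.
Variable L : language.

Fixpoint term_rename (V W : Type) (h : V -> W) (s : term L V) : term L W :=
  match s with
  | TVar x => TVar L (h x)
  | TApp f ss => TApp (fun i => term_rename h (ss i))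
  end.

Fixpoint formula_rename (V : Type) (phi : formula L V) :
    forall W : Type, (V -> W) -> formula L W :=
  match phi with
  | FTrue => fun W _ => FTrue L W
  | FEq s1 s2 => fun W h => FEq (term_rename h s1) (term_rename h s2)
  | FRel r ss => fun W h => FRel (fun i => term_rename h (ss i))
  | FNot psi => fun W h => FNot (formula_rename psi h)
  | FAnd psi1 psi2 => fun W h => FAnd (formula_rename psi1 h) (formula_rename psi2 h)
  | FOr psi1 psi2 => fun W h => FOr (formula_rename psi1 h) (formula_rename psi2 h)
  | FEx psi => fun W h => FEx (formula_rename psi (omap h))
  | FAll psi => fun W h => FAll (formula_rename psi (omap h))
  end.

Lemma eval_rename (M : structure L) (V W : Type) (h : V -> W) (v : W -> M) s :
  Defs.eval v (term_rename h s) = Defs.eval (v \o h) s.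
Proof. by elim: s => //= f ss IH; congr finterp; apply: funext => i; apply: IH. Qed.

Lemma oapp_omap (M : structure L) (V W : Type) (h : V -> W) (v : W -> M) a :
  oapp v a \o omap h = oapp (v \o h) a.
Proof. by apply: funext => -[]. Qed.

Lemma sat_rename (M : structure L) (V : Type) (phi : formula L V) :
  forall (W : Type) (h : V -> W) (v : W -> M),
  sat (formula_rename phi h) v <-> sat phi (v \o h).
Proof.
elim: phi => {V} /=.
- by [].
- by move=> V s1 s2 W h v; rewrite !eval_rename.
- move=> V r ss W h v.
  rewrite (_ : (fun i => _) = (fun i => Defs.eval (v \o h) (ss i))) //.
  by apply: funext => i; rewrite eval_rename.
- by move=> V psi IH W h v; rewrite IH.
- by move=> V p1 IH1 p2 IH2 W h v; rewrite IH1 IH2.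
- by move=> V p1 IH1 p2 IH2 W h v; rewrite IH1 IH2.
- by move=> V psi IH W h v; split=> -[a]; [rewrite IH oapp_omap|rewrite -oapp_omap -IH]; exists a.
- move=> V psi IH W h v; split=> H a; have := H a; first by rewrite IH oapp_omap.
  by rewrite IH oapp_omap.
Qed.

(** A block of [e] existential quantifiers, built one at a time: entry [ord0] becomes the variable
    [None] of the outermost quantifier. *)
Lemma ex_tuple_formula (e : nat) : forall (V : Type) (phi : formula L (V + 'I_e)),
  exists psi : formula L V, forall (M : structure L) (v : V -> M),
    sat psi v <-> exists w, sat phi (assign2 v w).
Proof.
elim: e => [|e IHe] V phi.
  pose h (s : V + 'I_0) : V :=
    match s with inl x => x | inr i => False_rect V (notF (ltn_ord i)) end.
  exists (formula_rename phi h) => M v; rewrite sat_rename.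
  have E (w : 'I_0 -> M) : assign2 v w = v \o h by apply: funext => -[x|[]].
  split=> [s|[w]]; last by rewrite E.
  by exists (fun i : 'I_0 => False_rect M (notF (ltn_ord i))); rewrite E.
pose h (s : V + 'I_e.+1) : option V + 'I_e :=
  match s with
  | inl x => inl (Some x)
  | inr i => if unlift ord0 i is Some j then inr j else inl None
  end.
have [psi psiP] := IHe _ (formula_rename phi h).
exists (FEx psi) => M v /=; split.
  move=> [a] /psiP[w]; rewrite sat_rename => s.
  exists (fun i => oapp w a (unlift ord0 i)).
  rewrite (_ : assign2 _ _ = assign2 (oapp v a) w \o h) //.
  by apply: funext => -[x|i] //=; case: (unlift _ _).
move=> [w s]; exists (w ord0); apply/psiP; exists (fun j => w (lift ord0 j)).
rewrite sat_rename (_ : _ \o h = assign2 v w) //.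
apply: funext => -[x|i] //=.
by case: (unliftP ord0 i) => [j ->|->].
Qed.

Lemma bool_comb_defined_rel (M : structure L) (T : theory L) (k p q : nat)
    (psi : formula L ('I_p + 'I_q)) : is_model T M ->
  bool_comb_formula (@semi_equation_formula L T k p q) psi ->
  bool_comb_set [set Q | semi_equation k Q] (defined_rel M psi).
Proof.
move=> MT; elim=> {psi} [psi h||psi _ IH|p1 p2 _ I1 _ I2|p1 p2 _ I1 _ I2].
- exact/bcs_gen/h.
- by rewrite (_ : defined_rel _ _ = setT); [apply: bcs_full|apply/seteqP].
- exact: (bcs_compl IH).
- exact: (bcs_inter I1 I2).
- exact: (bcs_union I1 I2).
Qed.

End Renaming.

(** Points of the affine plane against non-vertical lines, a line being coded by its slope and
    intercept. *)
Definition incidence (K : fieldType) : set ((K * K) * (K * K)) :=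
  [set z | z.1.2 = z.2.1 * z.1.1 + z.2.2].

(** * Point-line incidence of an interpreted field *)

Section InterpretedIncidence.
Variables (L : language) (M : structure L) (K : fieldType) (e : nat).
Variables (D : set ('I_e -> M)) (f : ('I_e -> M) -> K).

Definition join3 (T : Type) (t0 t1 t2 : 'I_e -> T) (ij : 'I_3 * 'I_e) : T :=
  match val ij.1 with 0%N => t0 ij.2 | 1%N => t1 ij.2 | _ => t2 ij.2 end.

Lemma coord_preimage3 (S : set ('I_3 -> K)) t0 t1 t2 :
  coord_preimage D f S (join3 t0 t1 t2) <->
  [/\ D t0, D t1, D t2 &
    S (fun i => match val i with 0%N => f t0 | 1%N => f t1 | _ => f t2 end)].
Proof.
have E : (fun i : 'I_3 => f (fun j => join3 t0 t1 t2 (i, j))) =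
    (fun i => match val i with 0%N => f t0 | 1%N => f t1 | _ => f t2 end).
  by apply: funext => -[[|[|[|i]]] ?].
rewrite /coord_preimage /= E; split=> [[dD s]|[D0 D1 D2 s]]; split=> //.
- exact: (dD (@Ordinal 3 0 isT)).
- exact: (dD (@Ordinal 3 1 isT)).
- exact: (dD (@Ordinal 3 2 isT)).
by move=> -[[|[|[|i]]] ?].
Qed.

Variables (c1 c2 : nat) (a1 : 'I_c1 -> M) (a2 : 'I_c2 -> M).
Variables (phi1 : formula L ('I_3 * 'I_e + 'I_c1)) (phi2 : formula L ('I_3 * 'I_e + 'I_c2)).
Hypothesis mulP : coord_preimage D f (graph_of (@ring_finterp K RMul)) =
  [set v | sat phi1 (assign2 v a1)].
Hypothesis addP : coord_preimage D f (graph_of (@ring_finterp K RAdd)) =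
  [set v | sat phi2 (assign2 v a2)].
Variable g : K -> 'I_e -> M.
Hypothesis gD : forall b, D (g b).
Hypothesis fg : forall b, f (g b) = b.

Let XV := ('I_2 * 'I_e)%type.
Let YV := ('I_2 * 'I_e + ('I_c1 + 'I_c2))%type.

Definition point_tuple (a : K * K) : 'I_#|{: XV}| -> M :=
  fun r => let: (i, j) := enum_val r in g (if i == ord0 then a.1 else a.2) j.

(** The parameters [a1] and [a2] of the definitions of product and sum are appended to every line,
    so that incidence is given by a formula without parameters, as semi-equationality requires. *)
Definition line_tuple (b : K * K) : 'I_#|{: YV}| -> M :=
  fun r => match enum_val r with
    | inl (i, j) => g (if i == ord0 then b.1 else b.2) j
    | inr (inl c) => a1 c
    | inr (inr c) => a2 c
    end.

Lemma point_tuple_inj : injective point_tuple.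
Proof.
move=> a b E.
have h (i : 'I_2) (j : 'I_e) :
    g (if i == ord0 then a.1 else a.2) j = g (if i == ord0 then b.1 else b.2) j.
  by have := congr1 (fun h => h (enum_rank ((i, j) : XV))) E; rewrite /point_tuple enum_rankK.
have h0 : g a.1 = g b.1 by apply: funext => j; apply: (h ord0).
have h1 : g a.2 = g b.2 by apply: funext => j; apply: (h ord_max).
by case: a b h0 h1 {E h} => [a b] [c d] /= /(congr1 f) + /(congr1 f); rewrite !fg => -> ->.
Qed.

Lemma line_tuple_inj : injective line_tuple.
Proof.
move=> a b E.
have h (i : 'I_2) (j : 'I_e) :
    g (if i == ord0 then a.1 else a.2) j = g (if i == ord0 then b.1 else b.2) j.
  by have := congr1 (fun h => h (enum_rank (inl (i, j) : YV))) E; rewrite /line_tuple enum_rankK.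
have h0 : g a.1 = g b.1 by apply: funext => j; apply: (h ord0).
have h1 : g a.2 = g b.2 by apply: funext => j; apply: (h ord_max).
by case: a b h0 h1 {E h} => [a b] [c d] /= /(congr1 f) + /(congr1 f); rewrite !fg => -> ->.
Qed.

(** The formula asks for an [e]-tuple [w] that represents the product of slope and abscissa and
    whose sum with the intercept is the ordinate. [h1] and [h2] place the arguments first and the
    value last, as in [graph_of]. *)
Lemma incidence_formula : exists phi : formula L ('I_#|{: XV}| + 'I_#|{: YV}|),
  forall a b, sat phi (assign2 (point_tuple a) (line_tuple b)) <-> incidence (a, b).
Proof.
pose V := (('I_#|{: XV}| + 'I_#|{: YV}|) + 'I_e)%type.
pose px (i : 'I_2) (j : 'I_e) : V := inl (inl (enum_rank ((i, j) : XV))).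
pose py (i : 'I_2) (j : 'I_e) : V := inl (inr (enum_rank (inl (i, j) : YV))).
pose pc (c : 'I_c1 + 'I_c2) : V := inl (inr (enum_rank (inr c : YV))).
pose h1 (s : 'I_3 * 'I_e + 'I_c1) : V :=
  match s with inl ij => join3 (py ord0) (px ord0) inr ij | inr c => pc (inl c) end.
pose h2 (s : 'I_3 * 'I_e + 'I_c2) : V :=
  match s with inl ij => join3 inr (py ord_max) (px ord_max) ij | inr c => pc (inr c) end.
have [phi phiP] := ex_tuple_formula (FAnd (formula_rename phi1 h1) (formula_rename phi2 h2)).
exists phi => -[x y] [u v]; rewrite phiP /incidence /=.
have E w : sat (FAnd (formula_rename phi1 h1) (formula_rename phi2 h2))
    (assign2 (assign2 (point_tuple (x, y)) (line_tuple (u, v))) w) <->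
    coord_preimage D f (graph_of (@ring_finterp K RMul)) (join3 (g u) (g x) w) /\
    coord_preimage D f (graph_of (@ring_finterp K RAdd)) (join3 w (g v) (g y)).
  rewrite mulP addP /= !sat_rename.
  set v1 := _ \o h1; set v2 := _ \o h2.
  have -> : v1 = assign2 (join3 (g u) (g x) w) a1.
    apply: funext => -[[[[|[|[|i]]] ?] j]|c] //=;
      by rewrite /v1 /= /join3 /= /point_tuple /line_tuple ?enum_rankK.
  have -> // : v2 = assign2 (join3 w (g v) (g y)) a2.
  apply: funext => -[[[[|[|[|i]]] ?] j]|c] //=;
    by rewrite /v2 /= /join3 /= /point_tuple /line_tuple ?enum_rankK.
split=> [[w /E[/coord_preimage3[_ _ _ /= E1] /coord_preimage3[_ _ _ /= E2]]]|yE].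
  by move: E1 E2; rewrite /graph_of /= !fg => -> .
exists (g (u * x)); apply/E; split; apply/coord_preimage3; split=> //;
by rewrite /graph_of /= !fg.
Qed.

End InterpretedIncidence.

Lemma interpretable_incidence (L : language) (M : structure L) (K : fieldType) :
  interpretable M (field_structure K) ->
  exists (p q : nat) (phi : formula L ('I_p + 'I_q)) (pt : K * K -> 'I_p -> M)
    (ln : K * K -> 'I_q -> M),
    [/\ injective pt, injective ln &
      forall a b, defined_rel M phi (pt a, ln b) <-> incidence (a, b)].
Proof.
move=> [e [D [f [_ fsurj _ ops _]]]].
have [c1 [a1 [phi1 mulP]]] := ops RMul; have [c2 [a2 [phi2 addP]]] := ops RAdd.
have /choice[g gP] : forall b, exists x, D x /\ f x = b.
  by move=> b; have [x Dx fx] := fsurj b; exists x.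
have gD b : D (g b) by have [] := gP b.
have fg b : f (g b) = b by have [] := gP b.
have [phi phiP] := incidence_formula mulP addP gD fg.
do 2 eexists; exists phi, (point_tuple g), (line_tuple a1 a2 g); split=> //.
  exact: point_tuple_inj fg.
exact: line_tuple_inj fg.
Qed.

(** * Grids with many incidences in an infinite field *)

Section Grids.
Variable K : fieldType.

(** [P] holds slopes and abscissas, [V] intercepts and [Q] ordinates. Since [V] lies in [Q], both
    points and lines can be drawn from the product of [P] and [Q], of size at most [2 * size P ^ 3],
    with at least [size P ^ 4] incidences. *)
Definition grid (P V Q : seq K) : Prop :=
  [/\ uniq P /\ uniq V, uniq Q, {subset V <= Q} &
    [/\ (size P ^ 2 <= size V)%N, (size Q <= 2 * size P ^ 2)%N &
      forall u x v, u \in P -> x \in P -> v \in V -> u * x + v \in Q]].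

(** Integers embed in characteristic 0, and [u * x + v < 2 * N ^ 2] when [u, x < N] and
    [v < N ^ 2]. *)
Lemma grid_pchar0 N : [pchar K] =i pred0 -> exists P V Q, grid P V Q /\ size P = N.
Proof.
move=> /pcharf0P K0.
have inj : injective (fun n : nat => n%:R : K).
  move=> m n /eqP; wlog mn : m n / (m <= n)%N.
    by move=> h; case: (leqP m n) => [/h//|/ltnW/h mn]; rewrite eq_sym => /mn->.
  by rewrite eq_sym -subr_eq0 -natrB // K0 subn_eq0 => nm; apply/eqP; rewrite eqn_leq mn.
exists [seq n%:R | n <- iota 0 N], [seq n%:R | n <- iota 0 (N ^ 2)],
  [seq n%:R | n <- iota 0 (2 * N ^ 2)].
rewrite /grid !size_map !size_iota !(map_inj_uniq inj) !iota_uniq.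
split=> //; split=> //.
  move=> _ /mapP[n + ->]; rewrite mem_iota => /andP[_ nN].
  by apply: map_f; rewrite mem_iota /=; lia.
split=> // _ _ _ /mapP[u + ->] /mapP[x + ->] /mapP[v + ->]; rewrite !mem_iota !add0n /= => uN xN vN.
by rewrite -natrM -natrD; apply: map_f; rewrite mem_iota /=; nia.
Qed.

Lemma infinite_nonroot (G : {poly K}) : infinite_set [set: K] -> G != 0 ->
  exists x, ~~ root G x.
Proof.
move=> infK G0; apply: contrapT => nex.
have [B _ sB] := infinite_set_fset (size G) infK.
have := max_poly_roots G0 (rs := finmap.enum_fset B) _ (finmap.fset_uniq B).
rewrite ltnNge sB => h; suff : false by []; apply: h.
by apply/allP => x _; apply/negPn/negP => nr; apply: nex; exists x.
Qed.

(** In positive characteristic these are the polynomials over the prime field, described inside [K]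
    itself. *)
Definition natural_coefs (q : {poly K}) : Prop := forall i, exists n : nat, q`_i = n%:R.

Lemma natural_coefsD q r : natural_coefs q -> natural_coefs r -> natural_coefs (q + r).
Proof.
by move=> hq hr i; have [m qm] := hq i; have [n rn] := hr i;
  exists (m + n)%N; rewrite coefD qm rn natrD.
Qed.

Lemma natural_coefsM q r : natural_coefs q -> natural_coefs r -> natural_coefs (q * r).
Proof.
move=> hq hr i; rewrite coefM; elim/big_ind: _ => [|_ _ [m ->] [n ->]|j _].
- by exists 0%N.
- by exists (m + n)%N; rewrite natrD.
by have [m ->] := hq j; have [n ->] := hr (i - j)%N; exists (m * n)%N; rewrite natrM.
Qed.

Section PositiveCharacteristic.
Variable p : nat.
Hypothesis pK : p \in [pchar K].

Lemma natr_inj_lt_pchar : {in gtn p &, injective (fun n : nat => n%:R : K)}.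
Proof.
move=> m n /=; rewrite !inE => mp np /eqP; wlog mn : m n mp np / (m <= n)%N.
  by move=> h; case: (leqP m n) => [/h|/ltnW/h H]; [apply|rewrite eq_sym => /H->].
rewrite eq_sym -subr_eq0 -natrB // -(dvdn_pcharf pK).
rewrite /dvdn modn_small; last by apply: leq_ltn_trans np; apply: leq_subr.
by rewrite subn_eq0 => nm; apply/eqP; rewrite eqn_leq mn.
Qed.

(** Strings of [m] base-[p] digits enumerate the polynomials of degree below [m] over the prime
    field. *)
Definition digit_poly m (c : {ffun 'I_m -> 'I_p}) : {poly K} :=
  \poly_(i < m) (if insub i is Some j then (c j)%:R else 0).

Lemma digit_polyE m (c : {ffun 'I_m -> 'I_p}) (i : 'I_m) : (digit_poly c)`_i = (c i)%:R.
Proof. by rewrite coef_poly ltn_ord valK. Qed.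

Lemma digit_poly_inj m : injective (@digit_poly m).
Proof.
move=> c d E; apply/ffunP => i; apply/val_inj/natr_inj_lt_pchar; rewrite ?inE ?ltn_ord //.
by rewrite -!digit_polyE E.
Qed.

Lemma digit_poly_onto m (q : {poly K}) : (size q <= m)%N -> natural_coefs q ->
  exists c : {ffun 'I_m -> 'I_p}, q = digit_poly c.
Proof.
move=> qm nq; have p0 : (0 < p)%N by have /pcharf_prime/prime_gt0 := pK.
have /choice[n nE] := nq.
exists [ffun i : 'I_m => Ordinal (ltn_pmod (n i) p0)]; apply/polyP => i.
have [im|mi] := ltnP i m; last first.
  by rewrite !nth_default // ?(leq_trans (size_poly _ _)) // (leq_trans qm).
by rewrite (digit_polyE _ (Ordinal im)) ffunE nE /= (GRing.natr_mod_pchar pK).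
Qed.

Lemma digit_poly_natural m (c : {ffun 'I_m -> 'I_p}) : natural_coefs (digit_poly c).
Proof.
move=> i; rewrite coef_poly; case: ifP => _; last by exists 0%N.
by case: insub => [j|]; [exists (c j)|exists 0%N].
Qed.

(* The degree of [x] over the prime field is at least [m]. *)
Lemma exists_large_degree m : infinite_set [set: K] ->
  exists x : K, injective (fun c : {ffun 'I_m -> 'I_p} => (digit_poly c).[x]).
Proof.
move=> infK.
(* A point outside the zeros of the product of all differences separates the values of all these
   polynomials. *)
pose G := \prod_(cd : {ffun 'I_m -> 'I_p} * {ffun 'I_m -> 'I_p} | cd.1 != cd.2)
  (digit_poly cd.1 - digit_poly cd.2).
have G0 : G != 0.
  by apply/prodf_neq0 => -[c d] /= cd; rewrite subr_eq0 (inj_eq (@digit_poly_inj m)).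
have [x xG] := infinite_nonroot infK G0.
exists x => c d E; apply/eqP; apply: contraNT xG => cd.
rewrite /G (bigD1 (c, d)) //= rootM; apply/orP; left.
by rewrite rootE !hornerE E subrr.
Qed.

(** [P] is the span of the first [s] powers of [x] over the prime field, and [V = Q] that of the
    first [2 s]; a product of two polynomials of size at most [s] again has size at most [2 s]. *)
Lemma grid_pchar s : infinite_set [set: K] ->
  exists P V Q, grid P V Q /\ size P = (p ^ s)%N.
Proof.
move=> infK; have [x xinj] := exists_large_degree (s + s) infK.
pose sp m := [seq (@digit_poly m c).[x] | c <- enum {ffun 'I_m -> 'I_p}].
have spE m y : reflect
      (exists2 q : {poly K}, (size q <= m)%N /\ natural_coefs q & y = q.[x])
      (y \in sp m).
  apply: (iffP mapP) => [[c _ ->]|[q [qm nq] ->]].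
    by exists (digit_poly c) => //; split; [apply: size_poly|apply: digit_poly_natural].
  by have [c ->] := digit_poly_onto qm nq; exists c; rewrite ?mem_enum.
have sp_size m : size (sp m) = (p ^ m)%N.
  by rewrite size_map -cardE card_ffun !card_ord.
have sp_uniq m : (m <= s + s)%N -> uniq (sp m).
  move=> ms; rewrite map_inj_in_uniq ?enum_uniq // => c d _ _ E.
  (* Shorter digit strings are padded to length [s + s], where evaluation at [x] is injective. *)
  have up (b : {ffun 'I_m -> 'I_p}) :
      exists b' : {ffun 'I_(s + s) -> 'I_p}, digit_poly b = digit_poly b'.
    apply: digit_poly_onto; last exact: digit_poly_natural.
    by rewrite (leq_trans (size_poly _ _)).
  have [c' cE] := up c; have [d' dE] := up d.
  by apply: digit_poly_inj; rewrite cE dE; congr digit_poly; apply: xinj; rewrite -cE -dE.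
exists (sp s), (sp (s + s)%N), (sp (s + s)%N); rewrite /grid !sp_size; split=> //.
split; rewrite ?sp_uniq ?leq_addr //; split.
- by rewrite -expnM muln2 addnn.
- by rewrite -expnM muln2 addnn leq_pmull.
move=> u y v /spE[qu [su nu] ->] /spE[qy [sy ny] ->] /spE[qv [sv nv] ->].
apply/spE; exists (qu * qy + qv); last by rewrite !hornerE.
split; last exact/natural_coefsD/nv/natural_coefsM.
apply: leq_trans (size_polyD _ _) _; rewrite geq_max sv andbT.
by apply: leq_trans (size_polyMleq _ _) _; apply: leq_trans (leq_pred _) (leq_add su sy).
Qed.

End PositiveCharacteristic.

Lemma exists_grid N : infinite_set [set: K] ->
  exists P V Q, grid P V Q /\ (N <= size P)%N.
Proof.
move=> infK; have [[p pK]|noK] := pselect (exists p, p \in [pchar K]).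
  have [P [V [Q [G sP]]]] := grid_pchar pK N infK; exists P, V, Q; split=> //.
  rewrite sP; apply/ltnW/ltn_expl; exact/prime_gt1/(pcharf_prime pK).
have [|P [V [Q [G sP]]]] := @grid_pchar0 N.
  by move=> p; apply/negP => pK; apply: noK; exists p.
by exists P, V, Q; rewrite sP.
Qed.

End Grids.

(** * Incidence has no almost linear bounds *)

Section IncidenceLowerBound.
Variables (F : realType) (K : fieldType) (X Y : Type) (R : set (X * Y)).
Variables (pt : K * K -> X) (ln : K * K -> Y).
Hypothesis pt_inj : injective pt.
Hypothesis ln_inj : injective ln.
Hypothesis RP : forall a b, R (pt a, ln b) <-> incidence (a, b).

(** Two points on two common lines satisfy [(u0 - u1) * (x0 - x1) = 0]: equal slopes force equal
    lines, and equal abscissas force equal points. *)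
Lemma incidence_K22_free (A : set X) (B : set Y) :
  A `<=` range pt -> B `<=` range ln -> Ktt_free 2 (R `&` (A `*` B)).
Proof.
move=> sA sB [A' [B' [/card_eq_ordP[a ai A'E] /card_eq_ordP[b bi B'E] sAB]]].
have inR i j : (R `&` (A `*` B)) (a i, b j).
  by apply: sAB; rewrite A'E B'E; split; [exists i|exists j].
have [[x0 y0] _ p0] : range pt (a ord0) by apply: sA; have [_ []] := inR ord0 ord0.
have [[x1 y1] _ p1] : range pt (a ord_max) by apply: sA; have [_ []] := inR ord_max ord0.
have [[u0 v0] _ l0] : range ln (b ord0) by apply: sB; have [_ []] := inR ord0 ord0.
have [[u1 v1] _ l1] : range ln (b ord_max) by apply: sB; have [_ []] := inR ord0 ord_max.
have [+ _] := inR ord0 ord0; have [+ _] := inR ord0 ord_max.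
have [+ _] := inR ord_max ord0; have [+ _] := inR ord_max ord_max.
rewrite -p0 -p1 -l0 -l1 !RP /incidence /= => E11 E10 E01 E00.
have : (u0 - u1) * (x0 - x1) = 0.
  have -> : (u0 - u1) * (x0 - x1) =
    (u0 * x0 + v0) - (u1 * x0 + v1) - (u0 * x1 + v0) + (u1 * x1 + v1) by ring.
  by rewrite -E00 -E01 -E10 -E11; ring.
move/eqP; rewrite mulf_eq0 !subr_eq0 => /orP[/eqP uE|/eqP xE].
  have vE : v0 = v1 by apply: (addrI (u0 * x0)); rewrite -E00 {1}E01 uE.
  by have /bi : b ord0 = b ord_max by rewrite -l0 -l1 uE vE.
have yE : y0 = y1 by rewrite E00 E10 xE.
by have /ai : a ord0 = a ord_max by rewrite -p0 -p1 xE yE.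
Qed.

(** A slope [u], an abscissa [x] and an intercept [v] determine the incidence of the point
    [(x, u * x + v)] with the line [(u, v)], and are recovered from it. *)
Lemma grid_incidences (P V Q : seq K) : grid P V Q ->
  (size P ^ 4 <= zarankiewicz 2 (size P * size Q) (size P * size Q) R)%N.
Proof.
move=> [[uP uV] uQ sVQ [PV QP cl]].
pose E := [seq (x, y) | x <- P, y <- Q].
have uE : uniq E by rewrite allpairs_uniq // => -[x y] [z w].
have sE : size E = (size P * size Q)%N by rewrite size_allpairs.
pose el (i : 'I_(size P * size Q)) := nth (0, 0) E i.
have el_inj : injective el.
  by move=> i j /eqP; rewrite nth_uniq ?sE ?ltn_ord // => /eqP/val_inj.
have elP z : z \in E -> exists i, el i = z.
  move=> zE; have iz : (index z E < size P * size Q)%N by rewrite -sE index_mem.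
  by exists (Ordinal iz); rewrite /el nth_index.
have K22 : Ktt_free 2 (R `&` (range (pt \o el) `*` range (ln \o el))).
  by apply: incidence_K22_free => _ [i _ <-]; exists (el i).
apply: leq_trans (edges_le_zarankiewicz (inj_comp pt_inj el_inj) (inj_comp ln_inj el_inj) K22).
rewrite edges_pairs.
pose W := ('I_(size P) * 'I_(size P) * 'I_(size V))%type.
pose u (w : W) := nth 0 P w.1.1; pose x (w : W) := nth 0 P w.1.2; pose v (w : W) := nth 0 V w.2.
have uin w : u w \in P by apply: mem_nth.
have xin w : x w \in P by apply: mem_nth.
have vin w : v w \in V by apply: mem_nth.
have /choice[h hP] : forall w : W, exists ij,
    el ij.1 = (x w, u w * x w + v w) /\ el ij.2 = (u w, v w).
  move=> w.
  have [i iE] : exists i, el i = (x w, u w * x w + v w).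
    by apply: elP; apply: allpairs_f => //; apply: cl.
  have [j jE] : exists j, el j = (u w, v w).
    by apply: elP; apply: allpairs_f => //; apply: sVQ.
  by exists (i, j).
have hi : injective h.
  move=> w1 w2 hE; have [p1 l1] := hP w1; have [p2 l2] := hP w2.
  rewrite hE p2 in p1; rewrite hE l2 in l1.
  case: p1 l1 => xE _ [uE' vE].
  case: w1 w2 xE uE' vE {hE p2 l2} => [[i j] k] [[i' j'] k'].
  rewrite /x /u /v /= => /eqP + /eqP + /eqP.
  by rewrite !nth_uniq // => /eqP/val_inj-> /eqP/val_inj-> /eqP/val_inj->.
apply: (@leq_trans #|h @: [set: W]%SET|); last first.
  apply/subset_leq_card/fintype.subsetP => _ /imsetP[w _ ->].
  rewrite inE; case hE: (h w) (hP w) => [i j] /= [p l].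
  by rewrite finset.in_setX !finset.in_setT /=; apply/asboolP; rewrite /= p l; apply/RP.
rewrite card_imset // cardsT !card_prod !card_ord.
by rewrite -[4%N]/(2 + 2)%N expnD [(size P * size P)%N]mulnn leq_mul2l PV orbT.
Qed.

Lemma incidence_not_almost_linear : infinite_set [set: K] ->
  ~ almost_linear_zarankiewicz F R.
Proof.
move=> infK aR.
(* The grids force exponent [4/3], so any value below [1/3] would do; with [1/6] the upper bound has
   order [a ^ (7/2)] against the lower bound [a ^ 4]. *)
have e0 : 0 < 1 / 6 :> F by lra.
have [C hC] := aR 2%N (1 / 6) isT e0.
pose c := `|C| * 2 `^ (7 / 6).
have c0 : 0 <= c by rewrite mulr_ge0 ?powR_ge0.
(* The two bounds give [a <= c ^ 2], so a grid with [size P] beyond [c ^ 2] is a contradiction. *)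
pose N := (Num.truncn (c ^+ 2)).+1.
have [P [V [Q [G sP]]]] := exists_grid N infK.
set a := size P in sP; set n := (a * size Q)%N.
have a0 : (0 < a)%N by apply: leq_trans sP.
have n0 : (0 < n)%N.
  have [[_ _] _ sVQ [PV _ _]] := G; rewrite muln_gt0 a0 /=.
  have V0 : (0 < size V)%N by apply: leq_trans PV; rewrite expn_gt0 a0.
  by case: V V0 sVQ {G PV} => // v V _ /(_ v (mem_head _ _)); case: (Q).
have an : (n <= 2 * a ^ 3)%N.
  have [_ _ _ [_ QP _]] := G; rewrite /n (expnS a 2) mulnCA leq_mul2l QP orbT //.
have low : a%:R ^+ 4 <= C * n%:R `^ (1 + 1 / 6).
  apply: le_trans _ (hC n n0); rewrite -natrX ler_nat; exact: (grid_incidences G).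
have aF : 1 <= a%:R :> F by rewrite ler1n.
have aF0 : 0 < a%:R :> F by rewrite ltr0n.
have up : a%:R ^+ 4 <= c * a%:R `^ (7 / 2).
  apply: (le_trans low); apply: (@le_trans _ _ (`|C| * (2 * a%:R ^+ 3) `^ (7 / 6))).
    apply: (le_trans (ler_wpM2r (powR_ge0 _ _) (ler_norm C))).
    apply: ler_wpM2l => //; rewrite (_ : 1 + 1 / 6 = 7 / 6); last lra.
    apply: ge0_ler_powR; rewrite ?nnegrE ?mulr_ge0 ?exprn_ge0 //.
    by rewrite -natrX -natrM ler_nat.
  rewrite powRM ?exprn_ge0 // -powR_mulrn // -powRrM mulrA.
  have -> : 3%:R * (7 / 6) = 7 / 2 :> F by lra.
  exact: lexx.
have halves : a%:R = a%:R `^ (1 / 2) ^+ 2 :> F.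
  have E : 1 / 2 * 2%:R = 1 :> F by lra.
  by rewrite -powR_mulrn ?powR_ge0 // -powRrM E powRr1.
have root_le : a%:R `^ (1 / 2) <= c.
  rewrite -(ler_pM2r (powR_gt0 (7 / 2) aF0)); apply: le_trans _ up.
  rewrite -powRD; last by rewrite gt_eqF ?implybT.
  have -> : 1 / 2 + 7 / 2 = 4%:R :> F by lra.
  by rewrite powR_mulrn.
have : a%:R <= c ^+ 2 by rewrite halves lerXn2r ?nnegrE ?powR_ge0.
apply/negP; rewrite -ltNge; apply: (lt_le_trans (truncnS_gt _)).
by rewrite ler_nat.
Qed.

End IncidenceLowerBound.

Local Close Scope card_scope.

Theorem theorem3p4 (F : realType) (k : nat) (hk : (0 < k)%N) :
  (forall (X Y : Type) (d d' : nat)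
      (Rp : 'I_d -> set (X * Y)) (Rn : 'I_d' -> set (X * Y)),
      (forall i, semi_equation k (Rp i)) ->
      (forall j, semi_equation k (Rn j)) ->
      forall t m n : nat, (0 < t)%N -> (0 < m)%N -> (0 < n)%N ->
        (zarankiewicz t m n
           ((\bigcap_i Rp i) `&` (\bigcap_j ~` Rn j)))%:R <=
        (if (0 < d')%N then
           8 ^+ (d + d' - 1) * k%:R ^+ (4 * d + d') * d'`!%:R
             * t%:R ^+ d'.+1 * (m + n)%:R * ln m.+1%:R ^+ (2 * d + d' - 1)
         else if (0 < d)%N then
           8 ^+ (d - 1) * k%:R ^+ (4 * d - 3) * (t%:R - 1) ^+ 2
             * (m + n)%:R * ln m.+1%:R ^+ (2 * d - 2)
         else (t%:R - 1) * (m + n)%:R :> F)) /\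
  (forall (X Y : Type) (R : set (X * Y)),
      bool_comb_set [set Q | semi_equation k Q] R ->
      almost_linear_zarankiewicz F R) /\
  (forall (L : language) (T : theory L),
      semi_equational k T -> ~ interprets_infinite_field T).
Proof.
split; last split.
- by move=> X Y d d' Rp Rn sp sn t m n t0 m0 _; apply: zarankiewicz_bound.
- by move=> X Y R bR; apply: (@bool_comb_almost_linear F X Y k hk).
move=> L T sT [M [K [MT infK /interpretable_incidence]]].
move=> [p [q [phi [pt [ln [pti lni phiP]]]]]].
(* In [M] the incidence formula agrees with a Boolean combination of semi-equations, whose almost
   linear bounds contradict the lower bound from grids. *)
have [psi bpsi psiE] := sT p q phi.
apply: (incidence_not_almost_linear (F := F) pti lni phiP infK).
have -> : defined_rel M phi = defined_rel M psi.
  by apply/seteqP; split=> z /psiE; apply.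
exact: bool_comb_almost_linear (bool_comb_defined_rel MT bpsi).
Qed.
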